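(* Let $G$ be the octahedral group of all rotations of $S^2$ preserving a fixed cube centered at the origin. For any finite subset $\alpha$ of $S^2$, $\mathcal{A}_\alpha=G\ (\simeq S_4)$ if and only if $\alpha$ is a union of (one or more) elements of $$\{V_O,F_O,E_O\}\cup\{B_O(X)\mid X\in S^2\setminus(V_O\cup F_O\cup E_O)\}.$$
   Context: $S^2$ is the unit sphere, identified with the extended complex plane $\widehat{\mathbb{C}}$ by stereographic projection; rotations of $S^2$ are thereby regarded as linear fractional transformations. For a finite subset $\alpha$, $\mathcal{A}_\alpha$ is the group of linear fractional transformations $h$ with $h(\alpha)=\alpha$. The cube is inscribed in $S^2$. $V_O$ is its set of $8$ vertices; $F_O$ and $E_O$ are the radial projections from the origin to $S^2$ of the centers of its $6$ faces and of the midpoints of its $12$ edges, respectively. For $X\in S^2\setminus(V_O\cup F_O\cup E_O)$, $B_O(X)$ is the $G$-orbit of $X$. *)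

(* Defs.v *)
From mathcomp Require Import all_boot all_order all_algebra all_fingroup.
From mathcomp Require Import complex.
From mathcomp Require Import boolp classical_sets functions cardinality reals.

Set Implicit Arguments.
Unset Strict Implicit.
Unset Printing Implicit Defensive.

Import Order.TTheory GRing.Theory Num.Theory.

Local Open Scope classical_set_scope.
Local Open Scope ring_scope.
Local Open Scope complex_scope.

(* The norm on matrices provided by mathcomp-analysis is the sup norm, hence
   the explicit Euclidean one. *)
Definition enorm (R : realType) (v : 'cV[R]_3) : R :=
  Num.sqrt (\sum_i v i 0 ^+ 2).

Definition sphere (R : realType) := {v : 'cV[R]_3 | enorm v == 1}.

(* [None] is the point at infinity. *)
Definition ecplane (R : realType) := option R[i].

(* Projection from the north pole (0, 0, 1) onto the equatorial plane. *)
Definition stereo (R : realType) (x : sphere R) : ecplane R :=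
  let v := val x in
  if v 2 0 == 1 then None
  else Some ((v 0 0 / (1 - v 2 0)) +i* (v 1 0 / (1 - v 2 0))).

Definition lft (R : realType) (a b c d : R[i]) (z : ecplane R) : ecplane R :=
  match z with
  | Some w => if c * w + d == 0 then None else Some ((a * w + b) / (c * w + d))
  | None => if c == 0 then None else Some (a / c)
  end.

Definition is_lft (R : realType) (h : ecplane R -> ecplane R) : Prop :=
  exists a b c d : R[i], a * d - b * c != 0 /\ h = lft a b c d.

Definition lft_stab (R : realType) (alpha : set (ecplane R)) :
    set (ecplane R -> ecplane R) :=
  [set h | is_lft h /\ h @` alpha = alpha].

(* Transport of self-maps of the sphere to self-maps of the extended plane
   along the bijection [stereo]. *)
Definition on_ecplane (R : realType) (G : set (sphere R -> sphere R)) :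
    set (ecplane R -> ecplane R) :=
  [set h : ecplane R -> ecplane R | exists2 g, G g & h \o @stereo R = @stereo R \o g].

Definition orthogonal_mx (R : realType) (Q : 'M[R]_3) : Prop :=
  Q^T *m Q = 1%:M.

Definition is_rotation (R : realType) (A : 'M[R]_3) : Prop :=
  orthogonal_mx A /\ \det A = 1.

(* A cube centered at the origin and inscribed in the unit sphere is given by
   an orthogonal matrix Q whose columns are the directions of its axes. Its
   half-side is 1 / sqrt 3. *)
Definition cube (R : realType) (Q : 'M[R]_3) : set 'cV[R]_3 :=
  [set x | forall i, `|(Q^T *m x) i 0| <= (Num.sqrt 3)^-1].

Definition vertex (R : realType) (Q : 'M[R]_3) (s : {ffun 'I_3 -> bool}) :
    'cV[R]_3 :=
  (Num.sqrt 3)^-1 *: \sum_i (-1) ^+ s i *: col i Q.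

(* The face (i, b) has the four vertices whose sign along axis i is b. *)
Definition face_center (R : realType) (Q : 'M[R]_3) (i : 'I_3) (b : bool) :
    'cV[R]_3 :=
  4^-1 *: \sum_(s : {ffun 'I_3 -> bool} | s i == b) vertex Q s.

(* An edge joins two vertices whose signs differ along exactly one axis. *)
Definition is_edge (s t : {ffun 'I_3 -> bool}) : bool :=
  #|[set i | s i != t i]%SET| == 1%N.

Definition edge_midpoint (R : realType) (Q : 'M[R]_3)
    (s t : {ffun 'I_3 -> bool}) : 'cV[R]_3 :=
  2^-1 *: (vertex Q s + vertex Q t).

Definition radial (R : realType) (v : 'cV[R]_3) : 'cV[R]_3 :=
  (enorm v)^-1 *: v.

Definition V_O (R : realType) (Q : 'M[R]_3) : set (sphere R) :=
  [set x | exists s, val x = vertex Q s].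

Definition F_O (R : realType) (Q : 'M[R]_3) : set (sphere R) :=
  [set x | exists i b, val x = radial (face_center Q i b)].

Definition E_O (R : realType) (Q : 'M[R]_3) : set (sphere R) :=
  [set x | exists s t, is_edge s t /\ val x = radial (edge_midpoint Q s t)].

Definition octahedral (R : realType) (Q : 'M[R]_3) :
    set (sphere R -> sphere R) :=
  [set g | exists A : 'M[R]_3,
    [/\ is_rotation A, mulmx A @` cube Q = cube Q
      & forall x, val (g x) = A *m val x]].

Definition B_O (R : realType) (Q : 'M[R]_3) (X : sphere R) : set (sphere R) :=
  [set g X | g in octahedral Q].

Definition octahedral_blocks (R : realType) (Q : 'M[R]_3) :
    set (set (sphere R)) :=
  [set V_O Q; F_O Q; E_O Q]
    `|` [set B_O Q X | X in ~` (V_O Q `|` F_O Q `|` E_O Q)].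

(* G, under composition, is isomorphic to the symmetric group on 4 letters;
   the product s * t of permutations applies s first. *)
Definition isog_S4 (T : Type) (G : set (T -> T)) : Prop :=
  exists phi : 'S_4 -> (T -> T),
    set_bij setT G phi /\ forall s t, phi (s * t)%g = phi t \o phi s.

(* Main.v *)
Require Import Defs.
From mathcomp Require Import all_boot all_order all_algebra all_fingroup.
From mathcomp Require Import cyclic complex.
From mathcomp Require Import boolp classical_sets functions cardinality reals.
From mathcomp Require Import zify ring lra.

(** Each of the blocks is an orbit of the octahedral group G ([block_orbit]) and
    each orbit is a block ([B_O_block]), so that the unions of one or more blocks
    are the nonempty G-invariant sets. It must be shown that the group K of the
    linear fractional maps stabilising a finite set is G if and only if the set is
    nonempty and G-invariant.

    If K = G, then the set is invariant, and it is nonempty because the empty set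
    is also stabilised by a translation ([lft_stab_set0_neq]). Conversely, let the
    set be nonempty and invariant. Rotations of the sphere are linear fractional
    ([rotation_lft]): in the Pauli basis a unit vector is a Hermitian matrix whose
    eigenline of eigenvalue 1 is its stereographic projection, and every rotation
    is induced by a conjugation, since it is the product of a half-turn and a
    rotation about the vertical axis, for which the conjugating matrices are
    explicit. So G is contained in K. Moreover K is finite, because three points
    determine a linear fractional map and orbits of G have at least three points.

    It remains to see that G is maximal among finite groups of linear fractional
    maps. A nontrivial element of finite order has exactly two fixed points
    ([lft_fix]), and counting the fixed points of all nontrivial elements by
    orbits is Klein's classification argument. Here only a part of it is needed,
    because K contains a quarter turn: some stabiliser has order divisible by 4
    and its orbit has more than two points, which leaves the orders 2, 3, 4 of the
    stabilisers as the only solution and gives #|K| = 24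
    ([perm_group_two_fixed_card], [two_fixed_group_max]).

    The group G itself is described through the four diagonals d_0, ..., d_3 of the
    cube, oriented towards the vertices of a regular tetrahedron. A permutation s
    acts by d_k -> sgn(s) d_(s k), which is a rotation preserving the cube, and
    every element of G is of this form ([octahedralP]); this gives the isomorphism
    with the symmetric group. Vertices, faces and edges of the cube are then
    given by the vectors +-d_j, d_j + d_k and d_j - d_k with j <> k, and their
    transitivity is the 2-transitivity of the alternating group on four letters. *)

Set Implicit Arguments.
Unset Strict Implicit.
Unset Printing Implicit Defensive.

Import Order.TTheory GRing.Theory Num.Theory.

Local Open Scope classical_set_scope.
Local Open Scope ring_scope.

(** * Counting the poles of a finite group with two fixed points per element *)

Lemma leq_mul_cofactor (m r n k : nat) : (m * r = n -> k <= r -> k * m <= n)%N.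
Proof. by move=> <- kr; rewrite [leqRHS]mulnC leq_mul2r kr orbT. Qed.

(** Klein's equation 1/r1 + 1/r2 + 1/r3 = 1 + 2/n, with m_i = n/r_i the sizes of
    the three orbits of poles. The triples with a sum above 1 are (2, 2, k),
    (2, 3, 3), (2, 3, 4) and (2, 3, 5); the multiple of 4 discards all but
    (2, 3, 4) and (2, 2, n/2), and [2 < m1] discards the latter, in which the
    orbit of the k-fold pole has two points. *)
Lemma pole_orbits_arith (n m1 m2 m3 r1 r2 r3 : nat) :
  (m1 * r1 = n -> m2 * r2 = n -> m3 * r3 = n -> m1 + m2 + m3 = n + 2 ->
  4 %| r1 -> 2 < m1 -> 1 < r2 -> 1 < r3 -> n = 24)%N.
Proof.
move=> e1 e2 e3 es r1_4 m1_gt2 r2_gt1 r3_gt1.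
have b2 := leq_mul_cofactor e2; have b3 := leq_mul_cofactor e3.
have [r1E|r1_ge8] : (r1 = 4 \/ 8 <= r1)%N.
  case/dvdnP: r1_4 => -[|[|k]] r1E; [|by left|by right; lia].
  by move: e1; rewrite r1E muln0; lia.
- have e1' : (4 * m1 = n)%N by rewrite -e1 r1E mulnC.
  have [E2|[E2|r2_ge4]] : (r2 = 2 \/ r2 = 3 \/ 4 <= r2)%N by lia.
  + have e2' : (2 * m2 = n)%N by rewrite -e2 E2 mulnC.
    have [E3|[E3|r3_ge4]] : (r3 = 2 \/ r3 = 3 \/ 4 <= r3)%N by lia.
    * by have e3' : (2 * m3 = n)%N; [rewrite -e3 E3 mulnC|lia].
    * by have e3' : (3 * m3 = n)%N; [rewrite -e3 E3 mulnC|lia].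
    * by have := b3 _ r3_ge4; lia.
  + have e2' : (3 * m2 = n)%N by rewrite -e2 E2 mulnC.
    have [E3|r3_ge3] : (r3 = 2 \/ 3 <= r3)%N by lia.
      by have e3' : (2 * m3 = n)%N; [rewrite -e3 E3 mulnC|lia].
    by have := b3 _ r3_ge3; lia.
  + by have := b2 _ r2_ge4; have := b3 _ r3_gt1; lia.
- have b1 := leq_mul_cofactor e1 r1_ge8.
  have [E2|r2_ge3] : (r2 = 2 \/ 3 <= r2)%N by lia.
    have e2' : (2 * m2 = n)%N by rewrite -e2 E2 mulnC.
    have [E3|r3_ge3] : (r3 = 2 \/ 3 <= r3)%N by lia.
      by have e3' : (2 * m3 = n)%N; [rewrite -e3 E3 mulnC|lia].
    by have := b3 _ r3_ge3; lia.
  by have := b2 _ r2_ge3; have := b3 _ r3_gt1; lia.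
Qed.

(** Counting the pairs (g, u) with g u = u in two ways. By the orbit-counting
    lemma, #|U| + 2 (#|H| - 1) is #|H| times the number of orbits. Every orbit
    has at most #|H| / 2 points, as stabilisers are nontrivial, which bounds the
    number of orbits by three; one or two orbits would not leave room for an
    orbit with more than two points. *)
Lemma perm_group_two_fixed_card (U : finType) (H : {group {perm U}}) (u0 : U)
    (p : {perm U}) :
    (forall g, g \in H -> g != 1%g -> #|[set u | g u == u]%SET| = 2%N) ->
    (forall u, exists2 g, g \in H & g != 1%g /\ g u = u) ->
    p \in H -> #[p]%g = 4%N -> p u0 = u0 -> (2 < #|orbit 'P H u0|)%N ->
  #|H| = 24%N.
Proof.
move=> fix2 nontriv pH op pu0 orb3.
set n := #|H|; set X := orbit 'P H @: [set: U]%SET.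
have actsT : [acts H, on [set: U]%SET | 'P].
  by apply/actsP => g gH x; rewrite !inE.
have n_gt1 : (1 < n)%N.
  rewrite cardG_gt1; apply/trivgPn; exists p => //.
  by apply: contra_eqN op => /eqP ->; rewrite order1.
have fixE (g : {perm U}) :
    #|'Fix_([set: U]%SET | 'P)[g]%g| = #|[set u | g u == u]%SET|.
  by apply: eq_card => u; rewrite finset.in_setI finset.in_setT [RHS]inE; apply/afix1P/eqP.
have sumfix : (#|U| + 2 * n.-1 = #|X| * n)%N.
  rewrite /X /n -(Frobenius_Cauchy actsT) (bigD1 1%g) ?group1 //=; congr (_ + _)%N.
    by rewrite fixE -cardsT; apply: eq_card => u; rewrite !inE perm1 eqxx.
  rewrite (eq_bigr (fun=> 2%N)); last first.
    by move=> g /andP[gH gn1]; rewrite fixE fix2.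
  rewrite sum_nat_const mulnC; congr (_ * _)%N.
  rewrite [#|H|](cardsD1 1%g) group1 /=.
  by apply: eq_card => g; rewrite !inE unfold_in andbC.
have sumorb : (\sum_(O in X) #|O| = #|U|)%N.
  by rewrite acts_sum_card_orbit // cardsT.
have orbr (O : {set U}) : O \in X -> exists2 r, (#|O| * r = n)%N & (1 < r)%N.
  case/imsetP => u _ ->; exists #|'C_H[u | 'P]%g|; first exact: card_orbit_stab.
  have [g gH [gn1 gu]] := nontriv u.
  rewrite (cardG_gt1 [group of 'C_H[u | 'P]%g]); apply/trivgPn; exists g => //.
  by rewrite inE gH; apply/astab1P; rewrite /= apermE.
set O1 := orbit 'P H u0 in orb3.
have O1X : O1 \in X by apply: imset_f.
have [r1 er1 r1_4] : exists2 r, (#|O1| * r = n)%N & (4 %| r)%N.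
  exists #|'C_H[u0 | 'P]%g|; first exact: card_orbit_stab.
  rewrite -op orderE; apply: cardSg; rewrite cycle_subG.
  by rewrite inE pH; apply/astab1P; rewrite /= apermE.
have cX : #|X| = (#|X :\ O1|.+1)%N by rewrite (cardsD1 O1) O1X.
have sX : (#|O1| + \sum_(O in X :\ O1) #|O| = #|U|)%N.
  by rewrite -sumorb [RHS](big_setD1 O1).
have half : (2 * \sum_(O in X :\ O1) #|O| <= #|X :\ O1| * n)%N.
  rewrite big_distrr /= -sum_nat_const; apply: leq_sum => O.
  by rewrite finset.in_setD => /andP[_ /orbr[r er r_gt1]]; apply: leq_mul_cofactor er r_gt1.
have quarter : (4 * #|O1| <= n)%N.
  apply: (leq_mul_cofactor er1); apply: dvdn_leq => //.
  by case: (r1) er1 => //; rewrite muln0; lia.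
have : #|X :\ O1| = 2%N.
  move: sumfix cX sX half quarter orb3 n_gt1.
  move: #|X :\ O1| #|O1| (\sum_(O in _) _)%N #|X| #|U| => k m1 s x u.
  move=> sumfix cX sX half quarter orb3 n_gt1; rewrite {}cX in sumfix.
  have [k0|[k1|[//|k3]]] : (k = 0 \/ k = 1 \/ k = 2 \/ 2 < k)%N by lia.
  - by subst k; lia.
  - by subst k; lia.
  - by have : (3 * n <= k * n)%N; [rewrite leq_mul2r k3 orbT|rewrite mulSn in sumfix; lia].
move=> c2; have [O2 [O3 [O23 eX]]] : exists O2 O3, O2 != O3 /\ X :\ O1 = [set O2; O3]%SET.
  by have /eqP/cards2P[O2 [O3 [h1 h2]]] := c2; exists O2, O3.
have [/orbr[r2 e2 r2_gt1] /orbr[r3 e3 r3_gt1]] : O2 \in X /\ O3 \in X.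
  have sub : [set O2; O3]%SET \subset X by rewrite -eX finset.subsetDl.
  by split; apply: (fintype.subsetP sub); rewrite !inE eqxx ?orbT.
rewrite eX big_setU1 ?inE //= big_set1 in sX.
apply: (pole_orbits_arith er1 e2 e3) => //.
rewrite -addnA sX; rewrite cX c2 in sumfix.
by move: sumfix n_gt1; move: #|U| (n : nat) => u m; lia.
Qed.

(** The abstract form of a finite group of linear fractional maps: what its order
    depends on is that a nontrivial element has exactly two fixed points. *)
Record two_fixed_group (T : Type) (K : set (T -> T)) : Prop := TwoFixedGroup {
  tfg_comp : forall f g, K f -> K g -> K (f \o g);
  tfg_inv : forall f, K f -> exists2 g, K g & cancel f g;
  tfg_finite : finite_set K;
  tfg_fix : forall f, K f -> f <> id ->
    exists p q, p <> q /\ forall x, f x = x <-> x = p \/ x = q }.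

(** Stated for a set of maps rather than for [two_fixed_group] because it is also
    what makes the stabiliser of a finite set finite. *)
Lemma eq_of_three_points (T : Type) (K : set (T -> T)) (f g : T -> T) (a b c : T) :
    (forall f g, K f -> K g -> K (f \o g)) ->
    (forall f, K f -> exists2 g, K g & cancel f g) ->
    (forall f, K f -> f <> id -> exists p q, forall x, f x = x -> x = p \/ x = q) ->
    K f -> K g -> a <> b -> a <> c -> b <> c ->
  f a = g a -> f b = g b -> f c = g c -> f = g.
Proof.
move=> KM KV Kfix Kf Kg ab ac bc fa fb fc.
have [g' Kg' gg'] := KV _ Kg.
have g'f_id : g' \o f = id.
  apply: contrapT => /(Kfix _ (KM _ _ Kg' Kf))[p [q fixE]].
  have fE x : f x = g x -> x = p \/ x = q by move=> e; apply/fixE; rewrite /= e gg'.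
  by move: (fE a fa) (fE b fb) (fE c fc) => [] ? [] ? [] ?; subst.
have [g'' Kg'' g'g''] := KV _ Kg'.
have g''E : g'' = g by apply/funext => x; rewrite -[in LHS](gg' x) g'g''.
apply/funext => x; rewrite -[LHS]g'g'' g''E; congr g.
exact: (congr1 (@^~ x) g'f_id).
Qed.

(** Maximality: K acts faithfully on the finite set P of the points fixed by some
    nontrivial element, and there it satisfies the hypotheses of
    [perm_group_two_fixed_card], so it has as many elements as its subgroup
    [range phi]. The points x0, phi h1 x0, phi h2 x0 serve both as three points
    of one orbit and for faithfulness, since they lie in P. *)
Lemma two_fixed_group_max (T : choiceType) (K : set (T -> T))
    (gT : finGroupType) (phi : gT -> T -> T) (x0 : T) (c h1 h2 : gT) :
    two_fixed_group K -> (forall s, K (phi s)) -> injective phi ->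
    phi 1%g = id -> (forall s t, phi (s * t)%g = phi t \o phi s) ->
    #|{: gT}| = 24%N -> #[c]%g = 4%N -> phi c x0 = x0 ->
    phi h1 x0 <> x0 -> phi h2 x0 <> x0 -> phi h1 x0 <> phi h2 x0 ->
  K = range phi.
Proof.
move=> KG Kphi phi_inj phi1 phiM cardG c4 cx0 h1x h2x h12.
pose P : set T := [set x | exists f, [/\ K f, f <> id & f x = x]].
have phiV s : cancel (phi s) (phi s^-1%g).
  by move=> x; have := congr1 (@^~ x) (phiM s s^-1%g); rewrite mulgV phi1 /= => <-.
have K1 : K id by rewrite -phi1.
have Pfin : finite_set P.
  have -> : P = \bigcup_(f in K `&` [set f | f <> id]) [set x | f x = x].
    by rewrite eqEsubset; split=> [x [f [Kf f1 fx]]|x [f [Kf f1] fx]]; exists f.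
  apply: bigcup_finite => [|f [Kf f1]].
    by apply: finite_setIl; apply: tfg_finite KG.
  have [p [q [_ fixE]]] := tfg_fix KG Kf f1.
  rewrite (_ : [set x | _] = [set p; q]) //.
  by rewrite eqEsubset; split=> x /fixE.
have Pstab f x : K f -> P x -> P (f x).
  move=> Kf [g [Kg g1 gx]]; have [f' Kf' ff'] := tfg_inv KG Kf.
  exists (f \o (g \o f')); split; last by rewrite /= ff' gx.
    by apply: (tfg_comp KG) => //; apply: (tfg_comp KG).
  move=> fgf; apply: g1; apply/funext => y.
  have := congr1 (@^~ (f y)) fgf; rewrite /= ff' => /(congr1 f').
  by rewrite !ff'.
have c_neq1 : c != 1%g by apply: contra_eqN c4 => /eqP ->; rewrite order1.
have Px0 : P x0.
  exists (phi c); split=> //; rewrite -phi1 => /phi_inj cE.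
  by rewrite cE eqxx in c_neq1.
have [s Ps] : exists s : seq T, P = [set` s] by apply/finite_seqP.
pose U : finType := seq_sub s.
have memP (u : U) : P (val u) by rewrite Ps; apply: valP.
have toU x : P x -> {u : U | val u = x}.
  by move=> Px; have xs : x \in s by [rewrite Ps in Px]; exists (SeqSub xs).
have permK f : K f -> exists p : {perm U}, forall u, val (p u) = f (val u).
  move=> Kf; pose F u := sval (toU _ (Pstab f _ Kf (memP u))).
  have FE u : val (F u) = f (val u) by rewrite /F; case: (toU _ _).
  have F_inj : injective F.
    move=> u v Fuv; apply: val_inj; have [f' _ ff'] := tfg_inv KG Kf.
    by rewrite -(ff' (val u)) -(ff' (val v)) -!FE Fuv.
  by exists (perm F_inj) => u; rewrite permE.
pose Hs := [set p : {perm U} | `[< exists2 f, K f & forall u, val (p u) = f (val u) >]]%SET.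
have Hgroup : group_set Hs.
  apply/group_setP; split.
    by rewrite inE; apply/asboolP; exists id => // u; rewrite perm1.
  move=> p q; rewrite !inE => -[f Kf pf] [g Kg qg]; exists (g \o f); first exact: (tfg_comp KG).
  by move=> u; rewrite permM qg pf.
pose H := Group Hgroup.
have [u0 u0E] := toU _ Px0.
have [u1 u1E] := toU _ (Pstab _ _ (Kphi h1) Px0).
have [u2 u2E] := toU _ (Pstab _ _ (Kphi h2) Px0).
have faithful f g : K f -> K g -> (forall u : U, f (val u) = g (val u)) -> f = g.
  move=> Kf Kg fg; apply: (eq_of_three_points (a := val u0) (b := val u1) (c := val u2)
    (tfg_comp KG) (tfg_inv KG) _ Kf Kg) => //.
  - move=> k Kk /(tfg_fix KG Kk)[p [q [_ fixE]]].
    by exists p, q => x /fixE.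
  - by rewrite u0E u1E => /esym.
  - by rewrite u0E u2E => /esym.
  - by rewrite u1E u2E.
pose psi t := sval (cid (permK _ (Kphi t))).
have psiE t u : val (psi t u) = phi t (val u) by rewrite /psi; case: (cid _).
have psiH t : psi t \in H by rewrite inE; apply/asboolP; exists (phi t).
have psi_inj : injective psi.
  by move=> t t' e; apply: phi_inj; apply: faithful => // u; rewrite -!psiE e.
have psiM : {in [set: gT]%SET &, {morph psi : t t' / (t * t')%g}}.
  by move=> t t' _ _; apply/permP => u; apply: val_inj; rewrite permM !psiE phiM.
have psi4 : #[psi c]%g = 4%N.
  rewrite -c4; apply: (order_injm (f := Morphism psiM)); rewrite ?inE //.
  by apply/injmP => t t' _ _; apply: psi_inj.
have cardH : #|H| = 24%N.
  apply: (perm_group_two_fixed_card (u0 := u0) (p := psi c)) => //.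
  - move=> p; rewrite inE => /asboolP[f Kf pf] p1.
    have f1 : f <> id.
      by move=> f1; move/eqP: p1; apply; apply/permP => u; apply: val_inj; rewrite pf f1 perm1.
    have [a [b [ab fixE]]] := tfg_fix KG Kf f1.
    have [a' aE] : {u : U | val u = a} by apply: toU; exists f; split=> //; apply/fixE; left.
    have [b' bE] : {u : U | val u = b} by apply: toU; exists f; split=> //; apply/fixE; right.
    have -> : [set u | p u == u]%SET = [set a'; b']%SET.
      apply/setP => u; rewrite !inE -(inj_eq val_inj) pf -!(inj_eq val_inj) aE bE.
      apply/eqP/orP => [/fixE[]->|]; rewrite ?eqxx; [by left|by right|].
      by move=> [] /eqP ?; apply/fixE; [left|right].
    by rewrite cards2; case: eqP => // a'b'; case: ab; rewrite -aE -bE a'b'.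
  - move=> u; have [f [Kf f1 fu]] := memP u; have [p pf] := permK f Kf.
    exists p; first by rewrite inE; apply/asboolP; exists f.
    split; last by apply: val_inj; rewrite pf.
    apply/eqP => p1; apply: f1; apply: faithful => // v.
    by rewrite -pf p1 perm1.
  - by apply: val_inj; rewrite psiE u0E.
  - have sub : [set u0; u1; u2]%SET \subset orbit 'P H u0.
      apply/fintype.subsetP => u; rewrite !inE -orbA => /or3P[]/eqP ->.
      - exact: orbit_refl.
      - apply/orbitP; exists (psi h1) => //; apply: val_inj.
        by rewrite /= apermE psiE u0E u1E.
      - apply/orbitP; exists (psi h2) => //; apply: val_inj.
        by rewrite /= apermE psiE u0E u2E.
    apply: leq_trans (subset_leq_card sub).
    rewrite -finset.setUA !cardsU1 cards1 !inE -!(inj_eq val_inj) u0E u1E u2E.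
    by do 3![case: eqP => [/esym//|_]].
rewrite eqEsubset; split=> [f Kf|f [t _ <-]//].
have [p pf] := permK f Kf.
have : p \in psi @: [set: gT]%SET.
  suff -> : psi @: [set: gT]%SET = H by rewrite inE; apply/asboolP; exists f.
  apply/eqP; rewrite eqEcard; apply/andP; split.
    by apply/fintype.subsetP => _ /imsetP[t _ ->].
  by rewrite card_imset // cardsT cardH cardG.
case/imsetP => t _ pE; exists t => //; apply: faithful => // u.
by rewrite -psiE -pE pf.
Qed.

(** * Linear fractional maps and their fixed points *)

(** The point with homogeneous coordinates [u : v]. *)
Definition proj (R : realType) (u v : R[i]) : ecplane R :=
  if v == 0 then None else Some (u / v).

Lemma projP (R : realType) (z : ecplane R) :
  exists u v, (u != 0) || (v != 0) /\ z = proj u v.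
Proof.
case: z => [w|].
- by exists w, 1; rewrite /proj oner_eq0 divr1 orbT.
- by exists 1, 0; rewrite /proj oner_eq0 eqxx.
Qed.

Lemma proj_eq (R : realType) (u v u' v' : R[i]) :
  (u != 0) || (v != 0) -> (u' != 0) || (v' != 0) -> u * v' = u' * v ->
  proj u v = proj u' v'.
Proof.
rewrite /proj => uv uv' e; have [v0|v0] := eqVneq v 0.
  rewrite v0 eqxx orbF in uv; move: e.
  by rewrite v0 mulr0 => /eqP; rewrite mulf_eq0 (negPf uv) => /= ->.
have [v'0|v'0] := eqVneq v' 0.
  rewrite v'0 eqxx orbF in uv'; move: e.
  rewrite v'0 mulr0 => /esym/eqP.
  by rewrite mulf_eq0 (negPf uv') (negPf v0).
by congr Some; apply/eqP; rewrite eqr_div // e.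
Qed.

(** In homogeneous coordinates a linear fractional map is linear, which spares
    the case analysis on the point at infinity from here on. *)
Lemma lft_proj (R : realType) (a b c d u v : R[i]) : (u != 0) || (v != 0) ->
  lft a b c d (proj u v) = proj (a * u + b * v) (c * u + d * v).
Proof.
rewrite /proj; have [->|v0] := eqVneq v 0.
  rewrite orbF !mulr0 !addr0 /= => u0; rewrite mulf_eq0 (negPf u0) orbF.
  by case: eqP => //= /eqP c0; congr Some; field; rewrite c0 u0.
move=> _ /=; have -> : c * (u / v) + d = (c * u + d * v) / v by field.
rewrite mulf_eq0 invr_eq0 (negPf v0) orbF; case: eqP => //= /eqP e0.
by congr Some; field; rewrite v0 e0.
Qed.

Lemma lin2_neq0 (F : fieldType) (a b c d u v : F) :
  a * d - b * c != 0 -> (u != 0) || (v != 0) ->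
  (a * u + b * v != 0) || (c * u + d * v != 0).
Proof.
move=> dt; apply: contraLR; rewrite !negb_or !negbK => /andP[/eqP e1 /eqP e2].
have e3 : (a * d - b * c) * u = 0.
  have -> : (a * d - b * c) * u = d * (a * u + b * v) - b * (c * u + d * v) by ring.
  by rewrite e1 e2 !mulr0 subr0.
have e4 : (a * d - b * c) * v = 0.
  have -> : (a * d - b * c) * v = a * (c * u + d * v) - c * (a * u + b * v) by ring.
  by rewrite e1 e2 !mulr0 subr0.
by move/eqP: e3; move/eqP: e4; rewrite !mulf_eq0 !(negPf dt) /= => -> ->.
Qed.

Lemma lft_comp (R : realType) (a b c d a' b' c' d' : R[i]) :
  a' * d' - b' * c' != 0 ->
  lft a b c d \o lft a' b' c' d' =
  lft (a * a' + b * c') (a * b' + b * d') (c * a' + d * c') (c * b' + d * d').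
Proof.
move=> dt; apply/funext => z /=; have [u [v [uv ->]]] := projP z.
rewrite !lft_proj ?lin2_neq0 //; congr proj; ring.
Qed.

Lemma lft_scalar (R : realType) (t : R[i]) : t != 0 -> lft t 0 0 t = id.
Proof.
move=> t0; apply/funext => -[w|] /=; last by rewrite eqxx.
by rewrite mul0r add0r (negPf t0) addr0 mulrAC divff // mul1r.
Qed.

Lemma is_lft_comp (R : realType) (h k : ecplane R -> ecplane R) :
  is_lft h -> is_lft k -> is_lft (h \o k).
Proof.
move=> [a [b [c [d [dt ->]]]]] [a' [b' [c' [d' [dt' ->]]]]].
do 4!eexists; split; last by rewrite lft_comp.
have -> : (a * a' + b * c') * (c * b' + d * d') - (a * b' + b * d') * (c * a' + d * c')
  = (a * d - b * c) * (a' * d' - b' * c') by ring.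
exact: mulf_neq0.
Qed.

Lemma is_lft_inv (R : realType) (h : ecplane R -> ecplane R) : is_lft h ->
  exists g, [/\ is_lft g, cancel h g & cancel g h].
Proof.
move=> [a [b [c [d [dt ->]]]]]; exists (lft d (- b) (- c) a).
have dt' : d * a - - b * - c != 0 by rewrite mulrNN mulrC.
split; first by exists d, (- b), (- c), a.
- move=> z; rewrite -[LHS]/((lft _ _ _ _ \o lft _ _ _ _) z) lft_comp //.
  rewrite (_ : _ + _ = a * d - b * c); last by ring.
  rewrite (_ : d * b + _ = 0); last by ring.
  rewrite (_ : - c * a + _ = 0); last by ring.
  rewrite (_ : - c * b + _ = a * d - b * c); last by ring.
  by rewrite lft_scalar.
- move=> z; rewrite -[LHS]/((lft _ _ _ _ \o lft _ _ _ _) z) lft_comp //.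
  rewrite (_ : a * d + _ = a * d - b * c); last by ring.
  rewrite (_ : a * - b + _ = 0); last by ring.
  rewrite (_ : c * d + _ = 0); last by ring.
  rewrite (_ : c * - b + _ = a * d - b * c); last by ring.
  by rewrite lft_scalar.
Qed.

(** The normal form z -> (a z + b) / d. For a <> d there is one finite fixed
    point; for a = d the map is a nontrivial translation, of infinite order
    because the characteristic is zero. *)
Lemma lft_affine_fix (R : realType) (h : ecplane R -> ecplane R) :
    is_lft h -> h None = None -> h <> id ->
  exists q, (forall z, h z = z <-> z = None \/ z = q) /\
    (None = q -> forall m, (0 < m)%N -> iter m h <> id).
Proof.
move=> [a [b [c [d [dt ->]]]]] /=; case: eqP => // c0 _ h1.
move: dt; rewrite c0 mulr0 subr0 mulf_eq0 negb_or => /andP[a0 d0].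
have hS w : lft a b 0 d (Some w) = Some ((a * w + b) / d).
  by rewrite /= mul0r add0r (negPf d0).
have hN : lft a b 0 d None = None by rewrite /= eqxx.
have [ad|ad] := eqVneq a d.
  have b0 : b != 0.
    by apply: contra_notN h1 => /eqP b0; rewrite c0 ad b0 lft_scalar.
  exists None; split=> [[w|]|_ m m0].
  - split; last by case.
    rewrite hS ad mulrDl [d * w]mulrC mulfK // => -[] /eqP.
    by rewrite -subr_eq0 addrC addKr mulf_eq0 invr_eq0 (negPf b0) (negPf d0).
  - by split=> // _; left.
  - have itE : iter m (lft a b 0 d) (Some 0) = Some (m%:R * (b / d)).
      elim: m {m0} => [|m IH]; first by rewrite mul0r.
      by rewrite iterS IH hS ad; congr Some; rewrite -natr1; field.
    move=> /(congr1 (@^~ (Some 0))); rewrite itE => -[] /eqP.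
    by rewrite !mulf_eq0 invr_eq0 (negPf b0) (negPf d0) pnatr_eq0 -leqn0 leqNgt m0.
have da0 : d - a != 0 by rewrite subr_eq0 eq_sym.
exists (Some (b / (d - a))); split=> // -[w|]; last by split=> // _; left.
rewrite hS; split=> [[] e|[] // [] ->]; last by congr Some; field; rewrite d0 da0.
right; congr Some; have {}e : a * w + b = w * d by rewrite -[in RHS]e divfK.
by apply: (mulIf da0); rewrite divfK // mulrBr -e; ring.
Qed.

(** The finite fixed points are the roots of c w^2 + (d - a) w - b. *)
Lemma lft_has_fix (R : realType) (h : ecplane R -> ecplane R) :
  is_lft h -> exists p, h p = p.
Proof.
move=> [a [b [c [d [dt ->]]]]]; have [->|c0] := eqVneq c 0.
  by exists None; rewrite /= eqxx.
pose s := sqrtc ((a - d) ^+ 2 + 4 * b * c).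
pose w := (a - d + s) / (2 * c).
have two0 : (2 : R[i]) != 0 by rewrite pnatr_eq0.
have eqw : a * w + b = (c * w + d) * w.
  have s2 : s ^+ 2 = (a - d) ^+ 2 + 4 * b * c by rewrite sqr_sqrtc.
  apply/eqP; rewrite -subr_eq0.
  have -> : a * w + b - (c * w + d) * w =
    ((a - d) ^+ 2 + 4 * b * c - s ^+ 2) / (4 * c).
    by rewrite /w; field; rewrite c0.
  by rewrite s2 subrr mul0r.
exists (Some w) => /=; have [e0|e0] := eqVneq (c * w + d) 0.
  have := @lin2_neq0 _ a b c d w 1 dt; rewrite oner_eq0 orbT !mulr1 eqw e0 mul0r.
  by rewrite eqxx => /(_ isT).
by congr Some; rewrite eqw mulrC mulKf.
Qed.

(** Conjugating a fixed point to infinity reduces to [lft_affine_fix]. A double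
    fixed point means a parabolic map; a map of finite order therefore has
    exactly two fixed points. *)
Lemma lft_fix (R : realType) (h : ecplane R -> ecplane R) :
    is_lft h -> h <> id ->
  exists p q, (forall z, h z = z <-> z = p \/ z = q) /\
    (p = q -> forall m, (0 < m)%N -> iter m h <> id).
Proof.
move=> hL h1; have [p hp] := lft_has_fix hL.
have [k [kL kN]] : exists k, is_lft k /\ k None = p.
  case: p {hp} => [w|]; last first.
    exists (lft 1 0 0 1); split; last by rewrite lft_scalar ?oner_eq0.
    by exists 1, 0, 0, 1; split=> //; rewrite mulr0 subr0 mulr1 oner_eq0.
  exists (lft w 1 1 0); split; last by rewrite /= oner_eq0 divr1.
  by exists w, 1, 1, 0; split=> //; rewrite mulr0 sub0r mulr1 oppr_eq0 oner_eq0.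
have [k' [k'L kK k'K]] := is_lft_inv kL.
pose h' := k' \o (h \o k).
have h'L : is_lft h' by apply: is_lft_comp => //; apply: is_lft_comp.
have h'1 : h' <> id.
  move=> e; apply: h1; apply/funext => z.
  by apply: (can_inj k'K); have := congr1 (@^~ (k' z)) e; rewrite /h' /= k'K.
have h'N : h' None = None by rewrite /h' /= kN hp -kN kK.
have [q [fixE inf]] := lft_affine_fix h'L h'N h'1.
exists p, (k q); split=> [z|pq m m0 e].
  have -> : h z = z <-> h' (k' z) = k' z.
    by rewrite /h' /= k'K; split=> [->//|/(congr1 k)]; rewrite !k'K.
  rewrite fixE -kN; split=> -[]; first by move=> /(congr1 k); rewrite k'K; left.
  - by move=> /(congr1 k); rewrite k'K; right.
  - by move=> ->; rewrite kK; left.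
  - by move=> ->; rewrite kK; right.
have qN : None = q by rewrite -(kK None) -(kK q) kN -pq.
apply: (inf qN m m0); apply/funext => z.
have -> n : iter n h' z = k' (iter n h (k z)).
  by elim: n => [|n IH]; rewrite ?kK // iterS IH /h' /= k'K.
by rewrite e /= kK.
Qed.

(** * Coordinates and determinants in dimensions two and three *)

Lemma ord3P (i : 'I_3) : [\/ i = 0, i = 1 | i = 2].
Proof. by case: i => -[|[|[|]]] // ?; [constructor 1|constructor 2|constructor 3];
  apply: val_inj.
Qed.

Lemma big_ord3 (V : nmodType) (F : 'I_3 -> V) : \sum_i F i = F 0 + F 1 + F 2.
Proof.
rewrite !big_ord_recl big_ord0 addr0 addrA.
by congr (F _ + F _ + F _); apply: val_inj.
Qed.

Lemma det_mx33 (F : comNzRingType) (A : 'M[F]_3) : \det A =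
  A 0 0 * (A 1 1 * A 2 2 - A 1 2 * A 2 1) - A 0 1 * (A 1 0 * A 2 2 - A 1 2 * A 2 0)
  + A 0 2 * (A 1 0 * A 2 1 - A 1 1 * A 2 0).
Proof.
rewrite (expand_det_row _ 0) big_ord3 /cofactor.
rewrite !(expand_det_row _ (0 : 'I_2)) !big_ord_recl !big_ord0 /cofactor !det_mx11 !mxE.
pose G (i j : nat) := A (inord i) (inord j).
have AE i j : A i j = G i j by rewrite /G !inord_val.
by rewrite !AE /bump /= !modn_small //=; ring.
Qed.

Lemma ord2P (i : 'I_2) : i = 0 \/ i = 1.
Proof. by case: i => -[|[|]] // ?; [left|right]; apply: val_inj. Qed.

Lemma big_ord2 (V : nmodType) (F : 'I_2 -> V) : \sum_i F i = F 0 + F 1.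
Proof. by rewrite !big_ord_recl big_ord0 addr0; congr (F _ + F _); apply: val_inj. Qed.

Lemma cV2_neq0 (F : fieldType) (p : 'cV[F]_2) : p != 0 -> (p 0 0 != 0) || (p 1 0 != 0).
Proof.
apply: contraNT; rewrite negb_or !negbK => /andP[/eqP p0 /eqP p1].
by apply/eqP/matrixP => i j; rewrite mxE ord1; have [->|->] := ord2P i.
Qed.

Lemma det_mx22 (F : comNzRingType) (A : 'M[F]_2) :
  \det A = A 0 0 * A 1 1 - A 0 1 * A 1 0.
Proof.
rewrite (expand_det_row _ 0) big_ord2 /cofactor !det_mx11 !mxE.
have l0 : lift (0 : 'I_2) (0 : 'I_1) = 1 by apply: val_inj.
have l1 : lift (1 : 'I_2) (0 : 'I_1) = 0 by apply: val_inj.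
by rewrite l0 l1 /= addn0 expr0 mul1r add0n !modn_small // expr1 mulN1r mulrN.
Qed.

(** * Rotations of the sphere are linear fractional *)

Local Open Scope complex_scope.

Lemma sphere_sqr (R : realType) (x : sphere R) :
  val x 0 0 ^+ 2 + val x 1 0 ^+ 2 + val x 2 0 ^+ 2 = 1.
Proof.
case: x => v /= /eqP e; have : enorm v ^+ 2 = 1 by rewrite e expr1n.
by rewrite /enorm sqr_sqrtr big_ord3 // !addr_ge0 ?sqr_ge0.
Qed.

(** The Hermitian matrix of a vector in the Pauli basis. For a unit vector its
    eigenvalues are 1 and -1, and the eigenline of 1, a point of the complex
    projective line, is the stereographic image of the vector. *)
Definition pauli (R : realType) (x : 'cV[R]_3) : 'M[R[i]]_2 :=
  \matrix_(i, j) (if i == 0 then if j == 0 then (x 2 0)%:C else x 0 0 +i* x 1 0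
                  else if j == 0 then x 0 0 -i* x 1 0 else - (x 2 0)%:C).

Definition cproj (R : realType) (p : 'cV[R[i]]_2) := proj (p 0 0) (p 1 0).

(** The two rows of the eigenvector equation are u (1 - z) = (x + iy) v and
    u (x - iy) = (1 + z) v: the first gives the ratio u / v away from the north
    pole, and the second gives v = 0 at the north pole. *)
Lemma stereo_eigen (R : realType) (x : sphere R) (p : 'cV[R[i]]_2) :
  p != 0 -> pauli (val x) *m p = p -> stereo x = cproj p.
Proof.
move=> /cV2_neq0 p0; have := sphere_sqr x; rewrite /stereo /cproj.
move: (val x) => v nv /matrixP e; have := e 0 0; have := e 1 0.
rewrite !mxE !big_ord2 !mxE /= => e1 e2; case: ifPn => [/eqP v2|v2].
  rewrite v2 in nv e1.
  have [v0 v1] : v 0 0 = 0 /\ v 1 0 = 0 by split; nra.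
  move: e1; rewrite v0 v1 oppr0 -[0 +i* 0]/(0 : R[i]) mul0r add0r rmorph1 mulN1r.
  by move=> /eqP; rewrite eq_sym -addr_eq0 -mulr2n mulrn_eq0 /= /proj => ->.
have d0 : 1 - v 2 0 != 0 by rewrite subr_eq0 eq_sym.
have dC0 : (1 - v 2 0)%:C != 0 by rewrite fmorph_eq0.
have -> : Some ((v 0 0 / (1 - v 2 0)) +i* (v 1 0 / (1 - v 2 0))) =
    proj (v 0 0 +i* v 1 0) (1 - v 2 0)%:C.
  rewrite /proj (negPf dC0); congr Some; apply: (mulIf dC0); rewrite divfK //.
  by simpc; rewrite !divfK.
apply: proj_eq => //; first by rewrite dC0 orbT.
rewrite -[in RHS]e2 rmorphB rmorph1.
rewrite [X in _ = X * _](_ : _ = p 0 0) //.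
rewrite mulrBr mulr1 -{1}e2; ring.
Qed.

Lemma stereo_eigen_ex (R : realType) (x : sphere R) :
  exists2 p : 'cV[R[i]]_2, p != 0 & pauli (val x) *m p = p.
Proof.
have := sphere_sqr x; move: (val x) => v nv.
have [v2|v2] := eqVneq (v 2 0) 1.
  have [v0 v1] : v 0 0 = 0 /\ v 1 0 = 0 by move: nv; rewrite v2 => nv; split; nra.
  exists (delta_mx 0 0).
    by apply/eqP => /matrixP/(_ 0 0); rewrite !mxE /= => /eqP; rewrite oner_eq0.
  apply/matrixP => i j; rewrite !mxE big_ord2 !mxE ord1 /=.
  by have [->|->] := ord2P i; rewrite /= ?v0 ?v1 ?v2; simpc.
exists (\col_i (if i == 0 then v 0 0 +i* v 1 0 else (1 - v 2 0)%:C)).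
  apply/eqP => /matrixP/(_ 1 0); rewrite !mxE /= => /eqP.
  by rewrite fmorph_eq0 subr_eq0 eq_sym (negPf v2).
apply/matrixP => i j; rewrite !mxE big_ord2 !mxE /=.
by have [->|->] := ord2P i; rewrite /=;
  apply/eqP; rewrite eq_complex /=; apply/andP; split; apply/eqP; nra.
Qed.

(** U covers A in the double cover of SO(3) by SU(2), except that U is only
    required to be invertible: the linear fractional map depends on U only up
    to a scalar, and this avoids square roots. *)
Definition spin (R : realType) (U : 'M[R[i]]_2) (A : 'M[R]_3) : Prop :=
  \det U != 0 /\ forall x, U *m pauli x = pauli (A *m x) *m U.

Lemma spin_mul (R : realType) (U V : 'M[R[i]]_2) (A B : 'M[R]_3) :
  spin U A -> spin V B -> spin (U *m V) (A *m B).
Proof.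
move=> [dU UA] [dV VB]; split; first by rewrite det_mulmx mulf_neq0.
by move=> x; rewrite -!mulmxA VB mulmxA UA -!mulmxA.
Qed.

(** U sends the eigenline of x to the eigenline of A x. *)
Lemma spin_lft (R : realType) (U : 'M[R[i]]_2) (A : 'M[R]_3)
    (g : sphere R -> sphere R) :
    spin U A -> (forall x, val (g x) = A *m val x) ->
  exists2 h, is_lft h & h \o @stereo R = @stereo R \o g.
Proof.
move=> [dU UA] gE; exists (lft (U 0 0) (U 0 1) (U 1 0) (U 1 1)).
  by do 4!eexists; split; last reflexivity; rewrite -det_mx22.
apply/funext => x /=; have [p p0 xp] := stereo_eigen_ex x.
have Up0 : U *m p != 0.
  apply: contra_neq p0 => Up; have Uu : U \in unitmx by rewrite unitmxE unitfE.
  by rewrite -(mulKmx Uu p) Up mulmx0.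
have gxUp : pauli (val (g x)) *m (U *m p) = U *m p.
  by rewrite gE mulmxA -UA -mulmxA xp.
rewrite (stereo_eigen p0 xp) (stereo_eigen Up0 gxUp) /cproj.
by rewrite lft_proj ?cV2_neq0 // !mxE !big_ord2.
Qed.

(** The vector [n] need not be a unit vector. *)
Definition half_turn (R : realType) (n : 'cV[R]_3) : 'M[R]_3 :=
  (2 / (n 0 0 ^+ 2 + n 1 0 ^+ 2 + n 2 0 ^+ 2)) *: (n *m n^T) - 1%:M.

Section HalfTurn.
Context (R : realType) (n : 'cV[R]_3).
Context (n0 : n 0 0 ^+ 2 + n 1 0 ^+ 2 + n 2 0 ^+ 2 != 0).

Lemma half_turnE i j : half_turn n i j =
  2 / (n 0 0 ^+ 2 + n 1 0 ^+ 2 + n 2 0 ^+ 2) * (n i 0 * n j 0) - (i == j)%:R.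
Proof. by rewrite !mxE big_ord1 !mxE. Qed.

Lemma half_turn_sqr : half_turn n *m half_turn n = 1%:M.
Proof.
apply/matrixP => i j; rewrite mxE big_ord3 !half_turnE mxE.
by have [->|->|->] := ord3P i; have [->|->|->] := ord3P j; rewrite /=; field.
Qed.

Lemma half_turn_tr : (half_turn n)^T = half_turn n.
Proof. by apply/matrixP => i j; rewrite mxE !half_turnE eq_sym [n j 0 * _]mulrC. Qed.

Lemma half_turn_rotation : is_rotation (half_turn n).
Proof.
split; first by rewrite /orthogonal_mx half_turn_tr half_turn_sqr.
by rewrite det_mx33 !half_turnE /=; field.
Qed.

(** The anticommutation relations give
    pauli n * pauli x * pauli n = 2 (n . x) pauli n - |n|^2 pauli x. *)
Lemma half_turn_spin : spin (pauli n) (half_turn n).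
Proof.
split.
  rewrite det_mx22 !mxE /=; simpc; rewrite eq_complex /= negb_and; apply/orP; left.
  by apply: contra n0 => /eqP e; apply/eqP; lra.
move=> x; apply/matrixP => i j; rewrite !mxE !big_ord2 !mxE !big_ord3 !half_turnE.
by have [->|->] := ord2P i; have [->|->] := ord2P j; rewrite /=;
  apply/eqP; rewrite eq_complex /=; apply/andP; split; apply/eqP; field.
Qed.

End HalfTurn.

Lemma orthogonal_mxC (R : realType) (A : 'M[R]_3) :
  orthogonal_mx A -> A *m A^T = 1%:M.
Proof. by move=> /mulmx1C. Qed.

Lemma rotation_mul (R : realType) (A B : 'M[R]_3) :
  is_rotation A -> is_rotation B -> is_rotation (A *m B).
Proof.
move=> [oA dA] [oB dB]; split; last by rewrite det_mulmx dA dB mulr1.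
by rewrite /orthogonal_mx trmx_mul -mulmxA (mulmxA _ A) oA mul1mx.
Qed.

(** A rotation fixing the north pole is a planar rotation, and acts on the plane
    as the multiplication by a complex number of modulus one. *)
Lemma polar_rotation_spin (R : realType) (A : 'M[R]_3) : is_rotation A ->
    A 0 2 = 0 -> A 1 2 = 0 -> A 2 2 = 1 ->
  exists U, spin U A.
Proof.
move=> [oA]; rewrite det_mx33 => dA a02 a12 a22.
move/matrixP: (orthogonal_mxC oA) => oA'; move/matrixP: oA => oA.
have := oA' 2 2; have := oA 0 0; have := oA 1 1; have := oA 0 1.
rewrite !mxE !big_ord3 !mxE /= a22 => e01 e11 e00 e22.
have [a20 a21] : A 2 0 = 0 /\ A 2 1 = 0 by split; nra.
rewrite a20 a21 in e01 e11 e00; rewrite a02 a12 a20 a21 a22 in dA.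
(* The sum of the squared norms of two columns, minus twice the determinant. *)
have sq0 : (A 1 1 - A 0 0) ^+ 2 + (A 0 1 + A 1 0) ^+ 2 = 0 by lra.
have [a11 a01] : A 1 1 = A 0 0 /\ A 0 1 = - A 1 0.
  move/eqP: sq0; rewrite paddr_eq0 ?sqr_ge0 // !sqrf_eq0 subr_eq0 addr_eq0.
  by move=> /andP[/eqP -> /eqP ->].
exists (\matrix_(i, j) (if i == 0 then if j == 0 then A 0 0 +i* A 1 0 else 0
                        else if j == 0 then 0 else 1)).
have e00' : A 0 0 ^+ 2 + A 1 0 ^+ 2 = 1 by rewrite -[RHS]e00; ring.
split.
  rewrite det_mx22 !mxE /= mulr1 mul0r subr0 eq_complex /= negb_and.
  rewrite -[A 0 0 == _]sqrf_eq0 -[A 1 0 == _]sqrf_eq0; have := oner_neq0 R.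
  rewrite -{1}e00'; apply: contraNT.
  by rewrite negb_or !negbK => /andP[/eqP -> /eqP ->]; rewrite addr0.
move=> x; apply/matrixP => i j; rewrite !mxE !big_ord2 !mxE !big_ord3.
rewrite a01 a11 a02 a12 a20 a21 a22.
have {}e00' : A 0 0 ^+ 2 = 1 - A 1 0 ^+ 2 by rewrite -e00' addrK.
by have [->|->] := ord2P i; have [->|->] := ord2P j; rewrite /=;
  apply/eqP; rewrite eq_complex /=; apply/andP; split; apply/eqP; ring: e00'.
Qed.

(** Composing with a half-turn that exchanges A e3 and e3 reduces any rotation to
    one about the vertical axis. *)
Lemma rotation_spin (R : realType) (A : 'M[R]_3) :
  is_rotation A -> exists U, spin U A.
Proof.
move=> rA; have [/matrixP oA _] := rA.
have := oA 2 2; rewrite !mxE big_ord3 !mxE /= => nA.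
have [n n0 [h0 h1 h2]] : exists2 n : 'cV[R]_3,
    n 0 0 ^+ 2 + n 1 0 ^+ 2 + n 2 0 ^+ 2 != 0
    & [/\ (half_turn n *m A) 0 2 = 0, (half_turn n *m A) 1 2 = 0
        & (half_turn n *m A) 2 2 = 1].
  have [a22|a22] := eqVneq (A 2 2) (-1).
    have [a02 a12] : A 0 2 = 0 /\ A 1 2 = 0 by rewrite a22 in nA; split; nra.
    (* Opposite vectors are exchanged by any half-turn with an orthogonal axis. *)
    exists (\col_i (i == 0)%:R).
      by rewrite !mxE /= expr1n expr0n !addr0 oner_eq0.
    rewrite !mxE !big_ord3 !half_turnE !mxE /= a02 a12 a22.
    by split; rewrite expr1n expr0n !addr0; lra.
  have nE : A 0 2 ^+ 2 + A 1 2 ^+ 2 + (A 2 2 + 1) ^+ 2 = 2 * (A 2 2 + 1).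
    by move: nA; nra.
  have n0 : 2 * (A 2 2 + 1) != 0 by rewrite mulf_neq0 ?pnatr_eq0 // addr_eq0.
  (* The axis bisects the angle of A e3 and e3. *)
  exists (\col_i (A i 2 + (i == 2)%:R)); first by rewrite !mxE /= !addr0 nE.
  rewrite !mxE !big_ord3 !half_turnE !mxE /= !addr0 nE.
  have a22' : A 2 2 + 1 != 0 by rewrite addr_eq0.
  have a02 : A 0 2 ^+ 2 = 1 - A 1 2 ^+ 2 - A 2 2 ^+ 2 by move: nA; nra.
  by split; apply: (mulfI a22'); field: a02.
have rH := half_turn_rotation n0.
have [U UB] := polar_rotation_spin (rotation_mul rH rA) h0 h1 h2.
exists (pauli n *m U); rewrite -[A]mul1mx -(half_turn_sqr n0) -mulmxA.
exact: spin_mul (half_turn_spin n0) UB.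
Qed.

(** The inverse of the stereographic projection, as a vector of the space. *)
Definition unstereo (R : realType) (z : ecplane R) : 'cV[R]_3 :=
  if z is Some (a +i* b) then
    (1 + a ^+ 2 + b ^+ 2)^-1 *: \col_i (if i == 0 then a *+ 2 else
                                        if i == 1 then b *+ 2
                                        else a ^+ 2 + b ^+ 2 - 1)
  else \col_i (i == 2)%:R.

Lemma enorm3 (R : realType) (v : 'cV[R]_3) :
  (enorm v == 1) = (v 0 0 ^+ 2 + v 1 0 ^+ 2 + v 2 0 ^+ 2 == 1).
Proof.
rewrite /enorm big_ord3 -{1}(@sqrtr1 R) eqr_sqrt ?ler01 //.
by rewrite !addr_ge0 ?sqr_ge0.
Qed.

Lemma unstereo_sphere (R : realType) (z : ecplane R) : enorm (unstereo z) == 1.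
Proof.
rewrite enorm3; case: z => [[a b]|] /=; last first.
  by rewrite !mxE /= expr0n expr1n /= !add0r.
have d0 : 1 + a ^+ 2 + b ^+ 2 != 0.
  by rewrite lt0r_neq0 // -addrA ltr_pwDl // addr_ge0 ?sqr_ge0.
by rewrite !mxE /=; apply/eqP; field.
Qed.

Lemma stereoK (R : realType) (x : sphere R) : unstereo (stereo x) = val x.
Proof.
have := sphere_sqr x; rewrite /stereo; move: (val x) => v nv.
apply/matrixP => i j; rewrite ord1 {j}; case: ifPn => [/eqP v2|v2] /=.
  have [v0 v1] : v 0 0 = 0 /\ v 1 0 = 0 by rewrite v2 in nv; split; nra.
  by rewrite mxE; have [->|->|->] := ord3P i; rewrite ?v0 ?v1 ?v2.
have d0 : 1 - v 2 0 != 0 by rewrite subr_eq0 eq_sym.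
have v0E : v 0 0 ^+ 2 = 1 - v 1 0 ^+ 2 - v 2 0 ^+ 2 by rewrite -nv; ring.
have e0 : 1 + (v 0 0 / (1 - v 2 0)) ^+ 2 + (v 1 0 / (1 - v 2 0)) ^+ 2 = 2 / (1 - v 2 0).
  by field: v0E.
rewrite e0 !mxE.
by have [->|->|->] := ord3P i; rewrite /=; field: v0E.
Qed.

Lemma stereo_inj (R : realType) : injective (@stereo R).
Proof. by move=> x y e; apply: val_inj; rewrite -!stereoK e. Qed.

Lemma stereo_surj (R : realType) (z : ecplane R) : exists x, stereo x = z.
Proof.
exists (exist (fun v => enorm v == 1) _ (unstereo_sphere z)); rewrite /stereo /=.
case: z => [[a b]|] /=; last by rewrite mxE /= eqxx.
have d0 : 1 + a ^+ 2 + b ^+ 2 != 0.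
  by rewrite lt0r_neq0 // -addrA ltr_pwDl // addr_ge0 ?sqr_ge0.
rewrite !mxE /=; case: eqP => [e|_].
  have := oner_neq0 R; rewrite -subr_eq0.
  have : (2 : R) != 0 by rewrite pnatr_eq0.
  move=> /eqP two0 _; case: two0; move/(congr1 ( *%R (1 + a ^+ 2 + b ^+ 2))): e.
  by rewrite mulrA divff // mulr1 mul1r; lra.
have e1 : 1 - (1 + a ^+ 2 + b ^+ 2)^-1 * (a ^+ 2 + b ^+ 2 - 1) =
   2 / (1 + a ^+ 2 + b ^+ 2) by field.
by rewrite e1; congr (Some (_ +i* _)); field.
Qed.

Lemma rotation_lft (R : realType) (A : 'M[R]_3) (g : sphere R -> sphere R) :
    is_rotation A -> (forall x, val (g x) = A *m val x) ->
  exists2 h, is_lft h & h \o @stereo R = @stereo R \o g.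
Proof. by move=> /rotation_spin[U UA]; apply: spin_lft UA. Qed.

Local Close Scope complex_scope.

(** * The octahedral group acts on the four diagonals of the cube *)

Definition dot (R : realType) (u v : 'cV[R]_3) : R := (u^T *m v) 0 0.

Lemma dotE (R : realType) (u v : 'cV[R]_3) :
  dot u v = u 0 0 * v 0 0 + u 1 0 * v 1 0 + u 2 0 * v 2 0.
Proof. by rewrite /dot mxE big_ord3 !mxE. Qed.

Lemma dotC (R : realType) (u v : 'cV[R]_3) : dot u v = dot v u.
Proof. by rewrite !dotE; ring. Qed.

Lemma dotDl (R : realType) (u v w : 'cV[R]_3) : dot (u + v) w = dot u w + dot v w.
Proof. by rewrite !dotE !mxE; ring. Qed.

Lemma dotZl (R : realType) a (u v : 'cV[R]_3) : dot (a *: u) v = a * dot u v.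
Proof. by rewrite !dotE !mxE; ring. Qed.

Lemma dot_mulmx (R : realType) (A : 'M[R]_3) (u v : 'cV[R]_3) :
  dot u (A *m v) = dot (A^T *m u) v.
Proof. by rewrite /dot trmx_mul trmxK mulmxA. Qed.

Lemma dot_orth (R : realType) (A : 'M[R]_3) (u v : 'cV[R]_3) :
  orthogonal_mx A -> dot (A *m u) (A *m v) = dot u v.
Proof. by move=> oA; rewrite dot_mulmx mulmxA oA mul1mx. Qed.

(** The vertices of the standard cube fall into four antipodal pairs; the chosen
    representatives are (1, 1, 1) and its images by the half-turns about the
    axes, those with an even number of minus signs. *)
Definition dsign (k : 'I_4) (i : 'I_3) : bool := ~~ ((k == 0 :> nat) || (k == i.+1 :> nat)).

Definition diag (R : realType) (k : 'I_4) : 'cV[R]_3 := \col_i (-1) ^+ dsign k i.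
Arguments diag {R} k.

Lemma ord4P (k : 'I_4) : [\/ k = 0, k = 1, k = 2 | k = 3].
Proof.
by case: k => -[|[|[|[|]]]] // ?;
  [constructor 1|constructor 2|constructor 3|constructor 4]; apply: val_inj.
Qed.

Lemma big_ord4 (V : nmodType) (F : 'I_4 -> V) : \sum_i F i = F 0 + F 1 + F 2 + F 3.
Proof.
rewrite !big_ord_recl big_ord0 addr0 !addrA.
by congr (F _ + F _ + F _ + F _); apply: val_inj.
Qed.

Lemma diagE (R : realType) : 
  [/\ [/\ @diag R 0 0 0 = 1, @diag R 0 1 0 = 1 & @diag R 0 2 0 = 1],
      [/\ @diag R 1 0 0 = 1, @diag R 1 1 0 = -1 & @diag R 1 2 0 = -1],
      [/\ @diag R 2 0 0 = -1, @diag R 2 1 0 = 1 & @diag R 2 2 0 = -1] &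
      [/\ @diag R 3 0 0 = -1, @diag R 3 1 0 = -1 & @diag R 3 2 0 = 1]].
Proof. by do !split; rewrite mxE /dsign /= ?expr0 ?expr1. Qed.

(** The [diag k] point to the vertices of a regular tetrahedron centered at the
    origin; this is its Gram matrix. *)
Lemma dot_diag (R : realType) j k : @dot R (diag j) (diag k) = 4 * (j == k)%:R - 1.
Proof.
have [[a1 a2 a3] [b1 b2 b3] [c1 c2 c3] [d1 d2 d3]] := diagE R.
have [->|->|->|->] := ord4P j; have [->|->|->|->] := ord4P k; rewrite dotE;
  by rewrite ?a1 ?a2 ?a3 ?b1 ?b2 ?b3 ?c1 ?c2 ?c3 ?d1 ?d2 ?d3 /=; ring.
Qed.

Lemma sum_diag (R : realType) : \sum_k @diag R k = 0.
Proof.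
have [[a1 a2 a3] [b1 b2 b3] [c1 c2 c3] [d1 d2 d3]] := diagE R.
have addE (u v : 'cV[R]_3) i : (u + v) i 0 = u i 0 + v i 0 by rewrite mxE.
apply/matrixP => i j; rewrite ord1 big_ord4 !addE [RHS]mxE.
by have [->|->|->] := ord3P i; rewrite ?a1 ?a2 ?a3 ?b1 ?b2 ?b3 ?c1 ?c2 ?c3 ?d1 ?d2 ?d3; ring.
Qed.

Lemma sum_diag_tr (R : realType) :
  \sum_k @diag R k *m (diag k)^T = 4%:M.
Proof.
have [[a1 a2 a3] [b1 b2 b3] [c1 c2 c3] [d1 d2 d3]] := diagE R.
have prodE k i j : (@diag R k *m (diag k)^T) i j = diag k i 0 * diag k j 0.
  by rewrite mxE big_ord1 [_^T _ _]mxE.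
apply/matrixP => i j; rewrite summxE big_ord4 !prodE [RHS]mxE.
have [->|->|->] := ord3P i; have [->|->|->] := ord3P j;
  rewrite /= ?a1 ?a2 ?a3 ?b1 ?b2 ?b3 ?c1 ?c2 ?c3 ?d1 ?d2 ?d3; by ring.
Qed.

Lemma diag_mx_eq (R : realType) (A B : 'M[R]_3) :
  (forall k, A *m diag k = B *m diag k) -> A = B.
Proof.
move=> AB; have /scalerI : (4 : R) != 0 by rewrite pnatr_eq0.
apply; rewrite -!mul_mx_scalar -sum_diag_tr !mulmx_sumr.
by apply: eq_bigr => k _; rewrite !mulmxA AB.
Qed.

(** The rotation sending [diag k] to the signature of s times [diag (s k)]
    ([rot_diag]). The linear map permuting the [diag k] as s does has
    determinant the signature of s, hence the twist by the sign, which in odd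
    dimension makes the determinant 1. *)
Definition rot (R : realType) (s : 'S_4) : 'M[R]_3 :=
  ((-1) ^+ s / 4) *: \sum_k diag (s k) *m (diag k)^T.
Arguments rot {R} s.

Lemma rot_diag (R : realType) (s : 'S_4) k :
  @rot R s *m diag k = (-1) ^+ s *: diag (s k).
Proof.
have four0 : (4 : R) != 0 by rewrite pnatr_eq0.
rewrite /rot -scalemxAl mulmx_suml -scalerA; congr (_ *: _); apply: (scalerI four0).
rewrite scalerA divff // scale1r.
have -> : \sum_i diag (s i) *m (diag i)^T *m diag k =
          \sum_i (4 * (i == k)%:R *: @diag R (s i) - diag (s i)).
  apply: eq_bigr => i _; rewrite -mulmxA [_^T *m _]mx11_scalar.
  by rewrite -/(dot _ _) dot_diag mul_mx_scalar scalerBl scale1r.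
have sum0 : \sum_i @diag R (s i) = 0.
  by rewrite -[RHS](sum_diag R); apply/esym/reindex_inj/perm_inj.
rewrite sumrB sum0 subr0 (bigD1 k) //= eqxx mulr1 big1 ?addr0 // => i ik.
by rewrite (negPf ik) mulr0 scale0r.
Qed.

Lemma rotM (R : realType) (s t : 'S_4) : @rot R (s * t)%g = rot t *m rot s.
Proof.
apply: diag_mx_eq => k; rewrite -mulmxA !rot_diag -scalemxAr rot_diag permM.
by rewrite scalerA odd_permM signr_addb.
Qed.

Lemma rot1 (R : realType) : @rot R 1%g = 1%:M.
Proof.
by apply: diag_mx_eq => k; rewrite rot_diag odd_perm1 perm1 scale1r mul1mx.
Qed.

Lemma rot_tr (R : realType) (s : 'S_4) : (@rot R s)^T = rot s^-1%g.
Proof.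
rewrite /rot linearZ odd_permV; congr (_ *: _); rewrite linear_sum /=.
rewrite (reindex_inj (@perm_inj _ s^-1%g)) /=; apply: eq_bigr => k _.
by rewrite trmx_mul trmxK permKV.
Qed.

Lemma rot_orth (R : realType) (s : 'S_4) : orthogonal_mx (@rot R s).
Proof. by rewrite /orthogonal_mx rot_tr -rotM mulgV rot1. Qed.

Lemma diag_inj (R : realType) (b c : bool) (j k : 'I_4) :
  (-1) ^+ b *: @diag R j = (-1) ^+ c *: diag k -> j = k.
Proof.
move=> e; have := congr1 (dot (diag j)) e; rewrite ![dot (diag j) _]dotC !dotZl !dot_diag eqxx.
by rewrite eq_sym; case: eqP => // _; case: b {e}; case: c => /=;
   rewrite ?expr0 ?expr1 => ?; exfalso; lra.
Qed.

Lemma rot_inj (R : realType) : injective (@rot R).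
Proof.
move=> s t e; apply/permP => k; apply: (@diag_inj R s t).
by rewrite -!rot_diag e.
Qed.

(** Adding a column of ones to the matrix with rows [diag k] makes it square and
    invertible. Permuting its rows by s is multiplying it on the right by the
    map that permutes the diagonals, extended by 1, so this map has the
    determinant of the permutation matrix of s. *)
Lemma rot_det (R : realType) (s : 'S_4) : \det (@rot R s) = 1.
Proof.
pose D : 'M[R]_(4, 3) := \matrix_(k, i) diag k i 0.
pose W : 'M[R]_(3 + 1) := row_mx D (const_mx 1).
pose M : 'M[R]_3 := (-1) ^+ s *: rot s.
have rowD k : row k D = (diag k)^T by apply/rowP => i; rewrite !mxE.
have DM : row_perm s D = D *m M^T.
  apply/row_matrixP => k; rewrite row_mul rowD -trmx_mul.
  rewrite -scalemxAl rot_diag scalerA -expr2 sqrr_sign scale1r -rowD.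
  by apply/rowP => i; rewrite !mxE.
have WM : row_perm s W = W *m block_mx M^T 0 0 1%:M.
  rewrite mul_row_block !mulmx0 addr0 add0r mulmx1 -DM.
  apply/matrixP => i j; rewrite mxE; case: (split_ordP j) => l ->.
    by rewrite !row_mxEl !mxE.
  by rewrite !row_mxEr !mxE.
have W0 : \det W != 0.
  (* W is a Hadamard matrix of order 4. *)
  have : \det (W *m W^T) != 0.
    have -> : W *m W^T = 4%:M.
      rewrite /W tr_row_mx mul_row_col; apply/matrixP => j k.
      rewrite [LHS]mxE (_ : (D *m D^T) j k = dot (diag j) (diag k)); last first.
        by rewrite dotE mxE big_ord3 !mxE.
      rewrite [X in _ + X]mxE big_ord1 !mxE mulr1 dot_diag.
      by case: eqP => _; rewrite ?mulr1n ?mulr0n ?mulr1 ?mulr0; ring.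
    by rewrite det_scalar expf_neq0 // pnatr_eq0.
  by rewrite det_mulmx mulf_eq0 negb_or => /andP[].
have detM : \det M = (-1) ^+ s.
  have -> : \det M = \det (block_mx M^T 0 0 1%:M : 'M_(3 + 1)).
    by rewrite det_lblock det1 mulr1 det_tr.
  by apply: (mulfI W0); rewrite -det_mulmx -WM row_permE det_mulmx det_perm mulrC.
have -> : rot s = (-1) ^+ s *: M by rewrite scalerA -expr2 sqrr_sign scale1r.
by rewrite detZ detM; case: (odd_perm s); rewrite /=; ring.
Qed.

Lemma cV3_eq (R : realType) (u v : 'cV[R]_3) :
  u 0 0 = v 0 0 -> u 1 0 = v 1 0 -> u 2 0 = v 2 0 -> u = v.
Proof.
by move=> h0 h1 h2; apply/matrixP => i j; rewrite ord1; have [->|->|->] := ord3P i.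
Qed.

Definition axis (R : realType) (i : 'I_3) : 'cV[R]_3 := delta_mx i 0.
Arguments axis {R} i.

Lemma dot_axis (R : realType) i (y : 'cV[R]_3) : dot (axis i) y = y i 0.
Proof. by have [->|->|->] := ord3P i; rewrite dotE !mxE /=; ring. Qed.

(** Two of the four vertices [diag k] always lie on a common face and are opposite
    on it, so that their midpoint is the center of that face: the six pairs of
    diagonals label the six faces. *)
Lemma axis_diagP (R : realType) (u : 'cV[R]_3) :
  (exists j k, j != k /\ u = 2^-1 *: (diag j + diag k)) <->
  (exists i (b : bool), u = (-1) ^+ b *: axis i).
Proof.
have two0 : (2 : R) != 0 by rewrite pnatr_eq0.
have E j k i (b : bool) : (forall l, diag j l 0 + diag k l 0 = 2 * (-1) ^+ b * (l == i)%:R :> R) ->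
    2^-1 *: (diag j + diag k) = (-1) ^+ b *: @axis R i.
  move=> e; apply: (scalerI two0); rewrite !scalerA divff // scale1r.
  by apply/matrixP => l m; rewrite ord1 mxE e !mxE eqxx andbT.
have [[a1 a2 a3] [b1 b2 b3] [c1 c2 c3] [d1 d2 d3]] := diagE R.
have e01 : 2^-1 *: (diag 0 + diag 1) = (-1) ^+ false *: @axis R 0.
  by apply: E => l; have [->|->|->] := ord3P l; rewrite ?a1 ?a2 ?a3 ?b1 ?b2 ?b3 /=; ring.
have e02 : 2^-1 *: (diag 0 + diag 2) = (-1) ^+ false *: @axis R 1.
  by apply: E => l; have [->|->|->] := ord3P l; rewrite ?a1 ?a2 ?a3 ?c1 ?c2 ?c3 /=; ring.
have e03 : 2^-1 *: (diag 0 + diag 3) = (-1) ^+ false *: @axis R 2.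
  by apply: E => l; have [->|->|->] := ord3P l; rewrite ?a1 ?a2 ?a3 ?d1 ?d2 ?d3 /=; ring.
have e23 : 2^-1 *: (diag 2 + diag 3) = (-1) ^+ true *: @axis R 0.
  by apply: E => l; have [->|->|->] := ord3P l; rewrite ?c1 ?c2 ?c3 ?d1 ?d2 ?d3 /=; ring.
have e13 : 2^-1 *: (diag 1 + diag 3) = (-1) ^+ true *: @axis R 1.
  by apply: E => l; have [->|->|->] := ord3P l; rewrite ?b1 ?b2 ?b3 ?d1 ?d2 ?d3 /=; ring.
have e12 : 2^-1 *: (diag 1 + diag 2) = (-1) ^+ true *: @axis R 2.
  by apply: E => l; have [->|->|->] := ord3P l; rewrite ?b1 ?b2 ?b3 ?c1 ?c2 ?c3 /=; ring.
split=> [[j [k [jk ->]]]|[i [b ->]]].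
  have [jE|jE|jE|jE] := ord4P j; have [kE|kE|kE|kE] := ord4P k; subst => //;
    do ?[rewrite (addrC (diag 1) (diag 0)) || rewrite (addrC (diag 2) (diag 0))
      || rewrite (addrC (diag 3) (diag 0)) || rewrite (addrC (diag 2) (diag 1))
      || rewrite (addrC (diag 3) (diag 1)) || rewrite (addrC (diag 3) (diag 2))];
    by rewrite ?e01 ?e02 ?e03 ?e23 ?e13 ?e12; eexists _, _.
have [->|->|->] := ord3P i; case: b; rewrite -?e01 -?e02 -?e03 -?e23 -?e13 -?e12;
  by eexists _, _; split; last reflexivity.
Qed.

Definition stdcube (R : realType) : set 'cV[R]_3 :=
  [set y | forall i, `|y i 0| <= (Num.sqrt 3)^-1].

(** The six face inequalities in terms of pairs of diagonals, a form on which the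
    action of [rot s] is visible. *)
Lemma stdcube_diagP (R : realType) (y : 'cV[R]_3) : stdcube y <->
  forall j k, j != k -> `|dot (2^-1 *: (diag j + diag k)) y| <= (Num.sqrt 3)^-1.
Proof.
have normE (b : bool) i : `|dot ((-1) ^+ b *: axis i) y| = `|y i 0|.
  by rewrite dotZl dot_axis normrM normrX normrN1 expr1n mul1r.
split=> [yc j k jk|yc i].
  have [i [b ->]] : exists i (b : bool), 2^-1 *: (diag j + diag k) = (-1) ^+ b *: @axis R i.
    by apply/axis_diagP; exists j, k.
  by rewrite normE; apply: yc.
have [j [k [jk e]]] : exists j k, j != k /\ (-1) ^+ false *: axis i = 2^-1 *: (@diag R j + diag k).
  by apply/axis_diagP; exists i, false.
by rewrite -(normE false) e; apply: yc.
Qed.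

Lemma rot_stdcube (R : realType) (s : 'S_4) (y : 'cV[R]_3) :
  stdcube y -> stdcube (rot s *m y).
Proof.
move=> /stdcube_diagP yc; apply/stdcube_diagP => j k jk.
rewrite dot_mulmx rot_tr -scalemxAr mulmxDr !rot_diag.
rewrite -scalerDr scalerA [2^-1 * _]mulrC -scalerA dotZl.
rewrite normrM normrX normrN1 expr1n mul1r.
by apply: yc; rewrite (inj_eq perm_inj).
Qed.

Lemma sign_vector_diag (R : realType) (y : 'cV[R]_3) :
  (forall i, y i 0 ^+ 2 = 1) -> exists (b : bool) k, y = (-1) ^+ b *: @diag R k.
Proof.
have [[a1 a2 a3] [b1 b2 b3] [c1 c2 c3] [d1 d2 d3]] := diagE R.
move=> y1; have ypm i : y i 0 = 1 \/ y i 0 = -1.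
  by have /eqP := y1 i; rewrite sqrf_eq1 => /orP[]/eqP; [left|right].
have scE (a : R) (v : 'cV[R]_3) i : (a *: v) i 0 = a * v i 0 by rewrite mxE.
have [h0|h0] := ypm 0; have [h1|h1] := ypm 1; have [h2|h2] := ypm 2.
- exists false, 0; apply: cV3_eq; rewrite scE ?h0 ?h1 ?h2 ?a1 ?a2 ?a3 /=; ring.
- exists true, 3; apply: cV3_eq; rewrite scE ?h0 ?h1 ?h2 ?d1 ?d2 ?d3 /=; ring.
- exists true, 2; apply: cV3_eq; rewrite scE ?h0 ?h1 ?h2 ?c1 ?c2 ?c3 /=; ring.
- exists false, 1; apply: cV3_eq; rewrite scE ?h0 ?h1 ?h2 ?b1 ?b2 ?b3 /=; ring.
- exists true, 1; apply: cV3_eq; rewrite scE ?h0 ?h1 ?h2 ?b1 ?b2 ?b3 /=; ring.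
- exists false, 2; apply: cV3_eq; rewrite scE ?h0 ?h1 ?h2 ?c1 ?c2 ?c3 /=; ring.
- exists false, 3; apply: cV3_eq; rewrite scE ?h0 ?h1 ?h2 ?d1 ?d2 ?d3 /=; ring.
- exists true, 0; apply: cV3_eq; rewrite scE ?h0 ?h1 ?h2 ?a1 ?a2 ?a3 /=; ring.
Qed.

(** Transport of [rot s] from the standard cube to the cube with axes Q. The
    determinant of Q, which may be -1, cancels out. *)
Definition oct_mx (R : realType) (Q : 'M[R]_3) (s : 'S_4) : 'M[R]_3 :=
  Q *m rot s *m Q^T.

Lemma cubeE (R : realType) (Q : 'M[R]_3) x : cube Q x = stdcube (Q^T *m x).
Proof. by []. Qed.

Lemma orth_det_sqr (R : realType) (Q : 'M[R]_3) : orthogonal_mx Q -> \det Q ^+ 2 = 1.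
Proof. by move=> oQ; rewrite expr2 -{1}det_tr -det_mulmx oQ det1. Qed.

Lemma oct_mxM (R : realType) (Q : 'M[R]_3) (s t : 'S_4) : orthogonal_mx Q ->
  oct_mx Q (s * t)%g = oct_mx Q t *m oct_mx Q s.
Proof.
move=> oQ; rewrite /oct_mx rotM -!mulmxA; congr (_ *m (_ *m _)).
by rewrite [RHS]mulmxA oQ mul1mx.
Qed.

Lemma oct_mx1 (R : realType) (Q : 'M[R]_3) : orthogonal_mx Q -> oct_mx Q 1%g = 1%:M.
Proof. by move=> oQ; rewrite /oct_mx rot1 mulmx1 orthogonal_mxC. Qed.

Lemma oct_mx_rotation (R : realType) (Q : 'M[R]_3) (s : 'S_4) : orthogonal_mx Q ->
  is_rotation (oct_mx Q s).
Proof.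
move=> oQ; split; last first.
  by rewrite !det_mulmx rot_det mulr1 det_tr -expr2 orth_det_sqr.
rewrite /orthogonal_mx /oct_mx !trmx_mul trmxK -!mulmxA (mulmxA Q^T Q) oQ mul1mx.
by rewrite (mulmxA (rot s)^T) rot_orth mul1mx orthogonal_mxC.
Qed.

Lemma oct_mx_tr (R : realType) (Q : 'M[R]_3) (s : 'S_4) (x : 'cV[R]_3) :
  orthogonal_mx Q -> Q^T *m (oct_mx Q s *m x) = rot s *m (Q^T *m x).
Proof. by move=> oQ; rewrite /oct_mx -!mulmxA (mulmxA Q^T Q) oQ mul1mx. Qed.

Lemma oct_mx_cube (R : realType) (Q : 'M[R]_3) (s : 'S_4) : orthogonal_mx Q ->
  mulmx (oct_mx Q s) @` cube Q = cube Q.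
Proof.
move=> oQ.
have sub t x : cube Q x -> cube Q (oct_mx Q t *m x).
  by rewrite !cubeE oct_mx_tr //; apply: rot_stdcube.
rewrite eqEsubset; split=> [_ [x xc <-]|x xc]; first exact: sub.
exists (oct_mx Q s^-1%g *m x); first exact: sub.
by rewrite mulmxA -oct_mxM // mulVg oct_mx1 // mul1mx.
Qed.

(** The points of the cube at distance 1 from the origin are its vertices, so an
    isometry preserving the cube permutes them: B diag_k = e_k diag_(f k) with
    signs e_k. Injectivity of f comes from the Gram matrix. The only linear
    relation between the diagonals is that their sum vanishes, so the e_k are
    all equal; as the determinant is 1, they are the signature of f. *)
Lemma stdcube_rotation (R : realType) (B : 'M[R]_3) : is_rotation B ->
  (forall y, stdcube y -> stdcube (B *m y)) -> exists s, B = rot s.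
Proof.
move=> [oB dB] Bc.
have c_gt0 : 0 < (Num.sqrt (3 : R))^-1 by rewrite invr_gt0 sqrtr_gt0.
have diag_cube k : stdcube ((Num.sqrt 3)^-1 *: @diag R k).
  move=> i; rewrite !mxE normrM normrX normrN1 expr1n mulr1 ger0_norm //; exact: ltW.
have Bd k : exists bf : bool * 'I_4, B *m diag k = (-1) ^+ bf.1 *: @diag R bf.2.
  suff [b [f e]] : exists (b : bool) f, B *m diag k = (-1) ^+ b *: @diag R f by exists (b, f).
  apply: sign_vector_diag.
  have le1 i : (B *m diag k) i 0 ^+ 2 <= 1.
    have := Bc _ (diag_cube k) i; rewrite -scalemxAr mxE normrM (ger0_norm (ltW c_gt0)).
    by rewrite ger_pMr // -real_normK ?num_real // => ?; apply: exprn_ile1.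
  have : dot (B *m diag k) (B *m diag k) = 3 by rewrite dot_orth // dot_diag eqxx /=; ring.
  rewrite dotE -!expr2 => e3 i; apply/eqP; rewrite eq_le le1 /=.
  by move: (le1 0) (le1 1) (le1 2) => l0 l1 l2; have [->|->|->] := ord3P i; lra.
have [F FE] := choice Bd; pose b k := (F k).1; pose f k := (F k).2.
have {}FE k : B *m diag k = (-1) ^+ b k *: @diag R (f k) by exact: FE.
have Bdot j k : dot (B *m diag j) (B *m diag k) = 4 * (j == k)%:R - 1.
  by rewrite dot_orth // dot_diag.
have f_inj : injective f.
  move=> j k fjk; have := Bdot j k; rewrite !FE dotZl dotC dotZl fjk dot_diag eqxx.
  case: eqP => // _; by case: (b j); case: (b k); rewrite /= ?expr0 ?expr1 => ?; exfalso; lra.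
pose s := perm f_inj.
have sumB : \sum_k (-1) ^+ b k *: @diag R (f k) = 0.
  by rewrite -(eq_bigr _ (fun k _ => FE k)) -mulmx_sumr sum_diag mulmx0.
have bE j : 4 * (-1) ^+ b j = \sum_k (-1) ^+ b k :> R.
  have : \sum_k dot ((-1) ^+ b k *: diag (f k)) (@diag R (f j)) = 0.
    transitivity (dot (\sum_k (-1) ^+ b k *: diag (f k)) (@diag R (f j))).
      by rewrite /dot linear_sum mulmx_suml summxE.
    by rewrite sumB dotE !mxE !mul0r !addr0.
  under eq_bigr => k _ do rewrite dotZl dot_diag mulrBr mulr1 (inj_eq f_inj).
  rewrite sumrB (bigD1 j) //= eqxx big1 ?addr0 => [|k kj].
    by rewrite mulr1 mulrC => /eqP; rewrite subr_eq0 => /eqP.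
  by rewrite (negPf kj) !mulr0.
have bconst k : (-1) ^+ b k = (-1) ^+ b 0 :> R.
  by apply: (@mulfI _ 4); rewrite ?pnatr_eq0 // !bE.
have BE : B = ((-1) ^+ b 0 * (-1) ^+ s) *: rot s.
  apply: diag_mx_eq => k; rewrite FE bconst -scalemxAl rot_diag scalerA -mulrA.
  by rewrite -expr2 sqrr_sign mulr1 permE.
exists s; rewrite BE; move: dB; rewrite BE detZ rot_det mulr1.
by case: (b 0); case: (odd_perm s) => /= e; rewrite ?expr0 ?expr1 in e *;
  rewrite ?mulrNN ?mulN1r ?mul1r ?mulr1 ?scale1r //; exfalso; lra.
Qed.

(** * The octahedral group as a group of maps of the sphere *)

Lemma enorm_dot (R : realType) (v : 'cV[R]_3) : (enorm v == 1) = (dot v v == 1).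
Proof. by rewrite enorm3 dotE. Qed.

Lemma orth_trK (R : realType) (Q : 'M[R]_3) (x : 'cV[R]_3) :
  orthogonal_mx Q -> Q *m (Q^T *m x) = x.
Proof. by move=> oQ; rewrite mulmxA orthogonal_mxC // mul1mx. Qed.

Lemma orth_Ktr (R : realType) (Q : 'M[R]_3) (x : 'cV[R]_3) :
  orthogonal_mx Q -> Q^T *m (Q *m x) = x.
Proof. by move=> oQ; rewrite mulmxA oQ mul1mx. Qed.

(** The default value of [insubd] is never reached when Q is orthogonal
    ([val_oct_map]). *)
Definition oct_map (R : realType) (Q : 'M[R]_3) (s : 'S_4) (x : sphere R) : sphere R :=
  insubd x (oct_mx Q s *m val x).

(** Coordinates along the axes of the cube. *)
Definition ccoord (R : realType) (Q : 'M[R]_3) (x : sphere R) : 'cV[R]_3 := Q^T *m val x.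

Section OctMap.
Context (R : realType) (Q : 'M[R]_3) (oQ : orthogonal_mx Q).

Lemma val_oct_map s x : val (oct_map Q s x) = oct_mx Q s *m val x.
Proof.
rewrite val_insubd enorm_dot dot_orth; last by case: (oct_mx_rotation s oQ).
by rewrite -enorm_dot (valP x).
Qed.

Lemma ccoord_inj : injective (ccoord Q).
Proof.
move=> x y e; apply: val_inj; rewrite -(orth_trK (val x) oQ) -(orth_trK (val y) oQ).
by rewrite -/(ccoord Q x) e.
Qed.

Lemma ccoord_oct_map s x : ccoord Q (oct_map Q s x) = rot s *m ccoord Q x.
Proof. by rewrite /ccoord val_oct_map oct_mx_tr. Qed.

Lemma dot_ccoord x : dot (ccoord Q x) (ccoord Q x) = 1.
Proof.
rewrite dot_orth; first by apply/eqP; rewrite -enorm_dot (valP x).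
by rewrite /orthogonal_mx trmxK orthogonal_mxC.
Qed.

Lemma ccoord_surj y : dot y y = 1 -> exists x, ccoord Q x = y.
Proof.
move=> y1; have Qy : enorm (Q *m y) == 1 by rewrite enorm_dot dot_orth // y1.
by exists (exist (fun v => enorm v == 1) _ Qy); rewrite /ccoord /= orth_Ktr.
Qed.

Lemma oct_mapM s t : oct_map Q (s * t)%g = oct_map Q t \o oct_map Q s.
Proof.
apply/funext => x; apply: ccoord_inj.
by rewrite /= !ccoord_oct_map rotM mulmxA.
Qed.

Lemma oct_map1 : oct_map Q 1%g = id.
Proof. by apply/funext => x; apply: ccoord_inj; rewrite ccoord_oct_map rot1 mul1mx. Qed.

Lemma dot_axis_axis i : dot (@axis R i) (axis i) = 1.
Proof. by rewrite dot_axis mxE !eqxx. Qed.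

Lemma oct_map_inj : injective (oct_map Q).
Proof.
move=> s t e; apply: (@rot_inj R); apply/matrixP => j i.
have [x xi] := ccoord_surj (dot_axis_axis i).
have : rot s *m @axis R i = rot t *m axis i by rewrite -xi -!ccoord_oct_map e.
by rewrite /axis -!colE => /matrixP/(_ j 0); rewrite !mxE.
Qed.

Lemma octahedralP g : octahedral Q g <-> exists s, g = oct_map Q s.
Proof.
split=> [[A [[oA dA] AQ gE]]|[s ->]]; last first.
  exists (oct_mx Q s); split; [exact: oct_mx_rotation|exact: oct_mx_cube|exact: val_oct_map].
pose B := Q^T *m A *m Q.
have rB : is_rotation B.
  split; last by rewrite !det_mulmx dA mulr1 det_tr -expr2 orth_det_sqr.
  rewrite /orthogonal_mx /B !trmx_mul trmxK -!mulmxA (mulmxA Q Q^T).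
  by rewrite orthogonal_mxC // mul1mx (mulmxA A^T) oA mul1mx.
have [s Bs] : exists s, B = rot s.
  apply: stdcube_rotation => // y yc.
  have : cube Q (A *m (Q *m y)) by rewrite -AQ; exists (Q *m y); rewrite // cubeE orth_Ktr.
  by rewrite cubeE /B -!mulmxA.
exists s; apply/funext => x; apply: ccoord_inj; rewrite ccoord_oct_map -Bs.
by rewrite /B /ccoord gE -!mulmxA orth_trK.
Qed.

Lemma isog_octahedral : isog_S4 (octahedral Q).
Proof.
exists (oct_map Q); split; last exact: oct_mapM.
split=> [s _|s t _ _|g /octahedralP[s ->]]; last by exists s.
  by apply/octahedralP; exists s.
exact: oct_map_inj.
Qed.

Lemma B_O_range x : B_O Q x = [set oct_map Q s x | s in setT].
Proof.
rewrite eqEsubset; split=> [_ [g /octahedralP[s ->] <-]|_ [s _ <-]]; first by exists s.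
by exists (oct_map Q s) => //; apply/octahedralP; exists s.
Qed.

End OctMap.

(** * The blocks are the orbits *)

(** The alternating group on four letters is 2-transitive: there are two letters
    besides j' and k', and swapping them corrects the parity. *)
Lemma perm4_pair (j k j' k' : 'I_4) (b : bool) : j != k -> j' != k' ->
  exists s : 'S_4, [/\ s j = j', s k = k' & odd_perm s = b].
Proof.
move=> jk jk'; pose s0 := (tperm j j' * tperm (tperm j j' k) k')%g.
have s0j : s0 j = j'.
  have := inj_eq (@perm_inj _ (tperm j j')) k j; rewrite tpermL => kj'.
  by rewrite permM tpermL tpermD // ?kj' ?[k' == _]eq_sym // eq_sym.
have s0k : s0 k = k' by rewrite permM tpermL.
have [e|e] := eqVneq (odd_perm s0) b; first by exists s0.
have : #|~: [set j'; k']%SET| == 2%N.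
  by rewrite cardsCs finset.setCK card_ord cards2 jk'.
case/cards2P => u [v [uv uvE]].
have uD : u \notin [set j'; k']%SET by rewrite -finset.in_setC uvE !inE eqxx.
have vD : v \notin [set j'; k']%SET by rewrite -finset.in_setC uvE !inE eqxx orbT.
move: uD vD; rewrite !inE !negb_or => /andP[uj uk] /andP[vj vk].
exists (s0 * tperm u v)%g; split.
- by rewrite permM s0j tpermD.
- by rewrite permM s0k tpermD.
by rewrite odd_permM odd_tperm uv; case: (odd_perm s0) b e => -[].
Qed.

Lemma ord4_other (j : 'I_4) : exists k, j != k.
Proof. by have [->|->|->|->] := ord4P j; [exists 1|exists 0|exists 0|exists 0]. Qed.

Definition svec (R : realType) (s : {ffun 'I_3 -> bool}) : 'cV[R]_3 := \col_i (-1) ^+ s i.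
Arguments svec {R} s.

Lemma vertexE (R : realType) (Q : 'M[R]_3) s :
  vertex Q s = (Num.sqrt 3)^-1 *: (Q *m svec s).
Proof.
rewrite /vertex; congr (_ *: _); apply/matrixP => i j.
by rewrite summxE mxE; apply: eq_bigr => k _; rewrite !mxE mulrC.
Qed.

Lemma svec_diag (R : realType) s : exists (b : bool) k, @svec R s = (-1) ^+ b *: diag k.
Proof. by apply: sign_vector_diag => i; rewrite mxE sqrr_sign. Qed.

Lemma diag_svec (R : realType) (b : bool) k :
  (-1) ^+ b *: @diag R k = svec [ffun i => b (+) dsign k i].
Proof. by apply/matrixP => i j; rewrite !mxE ffunE signr_addb. Qed.

Section Blocks.
Context (R : realType) (Q : 'M[R]_3) (oQ : orthogonal_mx Q).

Lemma V_OP x : V_O Q x <->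
  exists (b : bool) k, ccoord Q x = (Num.sqrt 3)^-1 *: ((-1) ^+ b *: diag k).
Proof.
split=> [[s xs]|[b [k xk]]].
  have [b [k e]] := svec_diag R s; exists b, k.
  by rewrite /ccoord xs vertexE -scalemxAr orth_Ktr // e.
exists [ffun i => b (+) dsign k i].
by rewrite -(orth_trK (val x) oQ) -/(ccoord Q x) xk vertexE -scalemxAr diag_svec.
Qed.

Lemma enormZ (a : R) (v : 'cV[R]_3) : 0 <= a -> enorm (a *: v) = a * enorm v.
Proof.
move=> a0; rewrite /enorm -[a in RHS](ger0_norm a0) -sqrtr_sqr -sqrtrM ?sqr_ge0 //.
by congr Num.sqrt; rewrite mulr_sumr; apply: eq_bigr => i _; rewrite mxE exprMn.
Qed.

Lemma radialZ (a : R) (v : 'cV[R]_3) : 0 < a -> dot v v = 1 -> radial (a *: v) = v.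
Proof.
move=> a0 /eqP; rewrite -enorm_dot => /eqP v1.
rewrite /radial enormZ ?ltW // v1 mulr1 scalerA mulVf ?scale1r //; exact: lt0r_neq0.
Qed.

(** Off the axis i the terms cancel in pairs under the flip of a sign. On
    it they are equal; their number disappears when the sum is normalised. *)
Lemma sum_face_svec i b :
  \sum_(s : {ffun 'I_3 -> bool} | s i == b) svec s =
  #|[pred s : {ffun 'I_3 -> bool} | s i == b]|%:R *: ((-1) ^+ b *: @axis R i).
Proof.
apply/matrixP => j l; rewrite ord1 {l} summxE !mxE eqxx andbT.
under eq_bigr => s _ do rewrite mxE.
have [->|ji] := eqVneq j i.
  rewrite mulr1 (eq_bigr (fun=> (-1) ^+ b)) => [|s /eqP -> //].
  by rewrite mulr_natl sumr_const.
rewrite !mulr0; set S := \sum_(_ | _) _.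
pose flip (s : {ffun 'I_3 -> bool}) := [ffun l => (l == j) (+) s l].
have flipK : involutive flip.
  by move=> s; apply/ffunP => l; rewrite !ffunE addbA addbb.
have SN : S = - S.
  rewrite {1}/S (reindex_inj (inv_inj flipK)) /= -sumrN; apply: eq_big => s.
    by rewrite ffunE [i == j]eq_sym (negPf ji).
  by move=> _; rewrite ffunE eqxx signr_addb mulN1r.
by move: SN; lra.
Qed.

Lemma radial_face_center i b : radial (face_center Q i b) = Q *m ((-1) ^+ b *: axis i).
Proof.
pose N := #|[pred s : {ffun 'I_3 -> bool} | s i == b]|.
have N0 : (0 < N)%N by apply/card_gt0P; exists [ffun=> b]; rewrite inE ffunE.
have -> : face_center Q i b =
    (4^-1 * (Num.sqrt 3)^-1 * N%:R) *: (Q *m ((-1) ^+ b *: axis i)).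
  rewrite /face_center; under eq_bigr => s _ do rewrite vertexE.
  by rewrite -scaler_sumr -mulmx_sumr sum_face_svec -scalemxAr !scalerA.
apply: radialZ; first by rewrite !mulr_gt0 ?invr_gt0 ?sqrtr_gt0 ?ltr0n.
by rewrite dot_orth // dotZl dotC dotZl dot_axis_axis mulr1 -expr2 sqrr_sign.
Qed.

Lemma F_OP x : F_O Q x <->
  exists j k, j != k /\ ccoord Q x = 2^-1 *: (diag j + diag k).
Proof.
rewrite axis_diagP; split=> -[i [b xib]]; exists i, b.
  by rewrite /ccoord xib radial_face_center orth_Ktr.
by rewrite radial_face_center -xib orth_trK.
Qed.

(** An edge joins [diag j] to the opposite of [diag k]: these are the neighbours of
    [diag j], the other three [diag k] being at distance two. *)
Lemma is_edgeP j k : j != k ->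
  is_edge [ffun i => false (+) dsign j i] [ffun i => true (+) dsign k i].
Proof.
rewrite /is_edge -sum1_card big_mkcond big_ord3 !inE !ffunE.
by have [->|->|->|->] := ord4P j; have [->|->|->|->] := ord4P k.
Qed.

(** Two sign vectors differing in one place have inner product 1, whereas that of
    e diag_j and e' diag_k is 3 e e' or -e e'. Hence j <> k and e' = -e, and the
    midpoint is along a difference of two diagonals. *)
Lemma edge_svec s t : is_edge s t ->
  exists j k, j != k /\ svec s + svec t = @diag R j - diag k.
Proof.
move=> /cards1P[i0 /setP st].
have dot1 : dot (svec s) (@svec R t) = 1.
  have st' i : (s i != t i) = (i == i0) by have := st i; rewrite !inE.
  have prodE i : (-1) ^+ s i * (-1) ^+ t i = (-1) ^+ (i == i0) :> R.
    by rewrite -st' -signr_addb; case: (s i); case: (t i).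
  rewrite dotE !mxE !prodE.
  by have [->|->|->] := ord3P i0; rewrite /=; ring.
have [b [j sj]] := svec_diag R s; have [c [k tk]] := svec_diag R t.
move: dot1; rewrite sj tk dotZl dotC dotZl dot_diag eq_sym.
case: eqP => [_|/eqP jk].
  by case: b {sj}; case: c {tk} => /= ?; exfalso; lra.
case: b {sj}; case: c {tk} => /= e; rewrite ?expr0 ?expr1 ?scale1r ?scaleN1r.
- by exfalso; lra.
- by exists k, j; rewrite eq_sym addrC.
- by exists j, k.
- by exfalso; lra.
Qed.

Lemma sqrt8_neq0 : Num.sqrt (8 : R) != 0.
Proof. by rewrite lt0r_neq0 // sqrtr_gt0. Qed.

Lemma dot_diagB j k : j != k ->
  dot ((Num.sqrt 8)^-1 *: (diag j - diag k)) ((Num.sqrt 8)^-1 *: (@diag R j - diag k)) = 1.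
Proof.
move=> jk; rewrite dotZl dotC dotZl.
have dotDr (u v w : 'cV[R]_3) : dot w (u - v) = dot w u - dot w v.
  by rewrite /dot mulmxBr !mxE.
have kj : (k == j) = false by rewrite eq_sym (negPf jk).
rewrite dotDr ![dot (_ - _) _]dotC !dotDr !dot_diag !eqxx kj (negPf jk) /=.
by rewrite mulrA -invfM -expr2 sqr_sqrtr // mulr1 mulr0; field.
Qed.

Lemma E_OP x : E_O Q x <->
  exists j k, j != k /\ ccoord Q x = (Num.sqrt 8)^-1 *: (diag j - diag k).
Proof.
have midE s t : edge_midpoint Q s t =
    (2^-1 * (Num.sqrt 3)^-1) *: (Q *m (svec s + svec t)).
  by rewrite /edge_midpoint !vertexE -scalerDr -mulmxDr scalerA.
have radE s t j k : j != k -> svec s + svec t = @diag R j - diag k ->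
    radial (edge_midpoint Q s t) = Q *m ((Num.sqrt 8)^-1 *: (diag j - diag k)).
  move=> jk e; rewrite midE.
  have -> : svec s + svec t = Num.sqrt 8 *: ((Num.sqrt 8)^-1 *: (@diag R j - diag k)).
    by rewrite e scalerA divff ?sqrt8_neq0 // scale1r.
  rewrite -[Q *m (Num.sqrt 8 *: _)]scalemxAr scalerA.
  apply: radialZ; last by rewrite dot_orth // dot_diagB.
  by rewrite !mulr_gt0 ?invr_gt0 ?sqrtr_gt0.
split=> [[s [t [/edge_svec[j [k [jk e]]] xst]]]|[j [k [jk xjk]]]].
  by exists j, k; split=> //; rewrite /ccoord xst (radE _ _ j k) // orth_Ktr.
do 2!eexists; split; first exact: (is_edgeP jk).
rewrite (radE _ _ j k) // -?diag_svec ?expr0 ?expr1 ?scale1r ?scaleN1r //.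
by rewrite -xjk orth_trK.
Qed.

Definition octahedral_orbit (B : set (sphere R)) :=
  B !=set0 /\ forall x, B x -> B = B_O Q x.

(** An invariant set on which the group is transitive is the orbit of each of its
    points. *)
Lemma orbit_of_family (B : set (sphere R)) : B !=set0 ->
    (forall x s, B x -> B (oct_map Q s x)) ->
    (forall x y, B x -> B y -> exists s, rot s *m ccoord Q x = ccoord Q y) ->
  octahedral_orbit B.
Proof.
move=> B0 Bstab Btrans; split=> // x Bx; rewrite B_O_range //.
rewrite eqEsubset; split=> [y By|_ [s _ <-]]; last exact: Bstab.
have [s e] := Btrans x y Bx By; exists s => //.
by apply: (ccoord_inj oQ); rewrite ccoord_oct_map.
Qed.

Lemma V_O_orbit : octahedral_orbit (V_O Q).
Proof.
apply: orbit_of_family.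
- have [|x xE] := @ccoord_surj R Q oQ ((Num.sqrt 3)^-1 *: diag 0).
    rewrite dotZl dotC dotZl dot_diag eqxx mulrA -invfM -expr2 sqr_sqrtr ?ler0n //=.
    by rewrite mulr1; field.
  by exists x; apply/V_OP; exists false, 0; rewrite xE /= scale1r.
- move=> x s /V_OP[b [k e]]; apply/V_OP; exists (b (+) odd_perm s), (s k).
  by rewrite ccoord_oct_map // e -!scalemxAr rot_diag signr_addb -scalerA.
- move=> x y /V_OP[b [j ->]] /V_OP[c [k ->]].
  have [j' jj'] := ord4_other j; have [k' kk'] := ord4_other k.
  have [s [sj _ so]] := perm4_pair (b (+) c) jj' kk'; exists s.
  rewrite -!scalemxAr rot_diag sj so [in LHS](scalerA ((-1) ^+ b)) -signr_addb.
  by rewrite addbA addbb addFb.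
Qed.

(** An odd permutation reverses the sum of two diagonals, which turns it into the
    sum of the two others. *)
Lemma F_O_orbit : octahedral_orbit (F_O Q).
Proof.
apply: orbit_of_family.
- have [x xE] := ccoord_surj oQ (@dot_axis_axis R 0).
  by exists x; apply/F_OP/axis_diagP; exists 0, false; rewrite xE scale1r.
- move=> x s /F_OP[j [k [jk e]]]; apply/F_OP.
  have [b|b] := boolP (odd_perm s); last first.
    exists (s j), (s k); rewrite (inj_eq perm_inj); split=> //.
    by rewrite ccoord_oct_map // e -scalemxAr mulmxDr !rot_diag (negPf b) !scale1r.
  have : #|~: [set s j; s k]%SET| == 2%N.
    by rewrite cardsCs finset.setCK card_ord cards2 (inj_eq perm_inj) jk.
  case/cards2P => u [v [uv uvE]]; exists u, v; split=> //.
  rewrite ccoord_oct_map // e -scalemxAr; congr (_ *: _).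
  rewrite mulmxDr !rot_diag b expr1 !scaleN1r -opprD; apply/eqP.
  rewrite eq_sym -addr_eq0 -[X in _ == X](sum_diag R).
  have sum2 a c : a != c -> \sum_(l in [set a; c]%SET) @diag R l = diag a + diag c.
    by move=> ac; rewrite big_setU1 ?big_set1 ?inE.
  rewrite (bigID (fun l => l \in [set s j; s k]%SET)) /= addrC; apply/eqP; congr (_ + _).
    by rewrite -sum2 // -uvE; apply: eq_bigl => l; rewrite finset.in_setC.
  by rewrite sum2 // (inj_eq perm_inj).
- move=> x y /F_OP[j [k [jk ->]]] /F_OP[j' [k' [jk' ->]]].
  have [s [sj sk so]] := perm4_pair false jk jk'; exists s.
  by rewrite -scalemxAr mulmxDr !rot_diag sj sk so !scale1r.
Qed.

Lemma E_O_orbit : octahedral_orbit (E_O Q).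
Proof.
apply: orbit_of_family.
- have j01 : (0 : 'I_4) != 1 by [].
  have [x xE] := ccoord_surj oQ (dot_diagB j01).
  by exists x; apply/E_OP; exists 0, 1.
- move=> x s /E_OP[j [k [jk e]]]; apply/E_OP.
  have sjk : s j != s k by rewrite (inj_eq perm_inj).
  have [b|b] := boolP (odd_perm s).
    exists (s k), (s j); rewrite eq_sym; split=> //.
    rewrite ccoord_oct_map // e -scalemxAr mulmxBr !rot_diag b expr1 !scaleN1r.
    by rewrite opprK addrC.
  exists (s j), (s k); split=> //.
  by rewrite ccoord_oct_map // e -scalemxAr mulmxBr !rot_diag (negPf b) !scale1r.
- move=> x y /E_OP[j [k [jk ->]]] /E_OP[j' [k' [jk' ->]]].
  have [s [sj sk so]] := perm4_pair false jk jk'; exists s.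
  by rewrite -scalemxAr mulmxBr !rot_diag sj sk so !scale1r.
Qed.

Lemma B_O_orbit x : octahedral_orbit (B_O Q x).
Proof.
rewrite B_O_range //; split; first by exists x, 1%g => //; rewrite oct_map1.
move=> _ [s _ <-]; rewrite B_O_range // eqEsubset; split=> _ [t _ <-].
  exists (s^-1 * t)%g => //.
  have := congr1 (@^~ x) (oct_mapM oQ s (s^-1 * t)%g); rewrite mulKVg /= => ->.
  by [].
by exists (s * t)%g => //; rewrite oct_mapM.
Qed.

Lemma block_orbit B : octahedral_blocks Q B -> octahedral_orbit B.
Proof.
move=> [[[->|->]|->]|[x _ <-]];
  [exact: V_O_orbit|exact: F_O_orbit|exact: E_O_orbit|exact: B_O_orbit].
Qed.

Lemma B_O_block x : octahedral_blocks Q (B_O Q x).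
Proof.
have [[[Vx|Fx]|Ex]|nx] := pselect ((V_O Q `|` F_O Q `|` E_O Q) x); last by right; exists x.
- by rewrite -(V_O_orbit.2 x Vx); left; left; left.
- by rewrite -(F_O_orbit.2 x Fx); left; left; right.
- by rewrite -(E_O_orbit.2 x Ex); left; right.
Qed.

(** Blocks are nonempty and are orbits, and every orbit is a block; a union of
    orbits is the same as an invariant set. *)
Lemma union_blocksP (alpha : set (sphere R)) :
  (exists S : set (set (sphere R)), [/\ S `<=` octahedral_blocks Q, S !=set0
     & alpha = \bigcup_(B in S) B]) <->
  alpha !=set0 /\ forall s x, alpha x -> alpha (oct_map Q s x).
Proof.
split=> [[S [Sb [B SB] ->]]|[[x ax] astab]].
  split; first by have [[x Bx] _] := block_orbit (Sb B SB); exists x, B.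
  move=> s x [C SC Cx]; exists C => //.
  by have [_ /(_ x Cx) ->] := block_orbit (Sb C SC); rewrite B_O_range //; exists s.
exists (B_O Q @` alpha); split.
- by move=> _ [y _ <-]; apply: B_O_block.
- by exists (B_O Q x), x.
rewrite eqEsubset; split=> [y ay|y [_ [z az <-]]].
  exists (B_O Q y); first by exists y.
  by rewrite B_O_range //; exists 1%g => //; rewrite oct_map1.
by rewrite B_O_range // => -[s _ <-]; apply: astab.
Qed.

(** * Small orbits and stabilisers *)

Lemma tperm_if (T : finType) (a b c : T) :
  tperm a b c = if c == a then b else if c == b then a else c.
Proof. by case: tpermP => [->|->|/eqP/negPf -> /eqP/negPf ->//]; rewrite eqxx //; case: eqP. Qed.

Ltac tperm_compute := do ?rewrite permM; rewrite !tperm_if; apply/eqP.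

(** A 3-cycle moving x provides two more points. If both 3-cycles below fixed x,
    its inner products with the four diagonals would be equal; their sum is
    zero, so x would be zero. *)
Lemma orbit_three x : exists s t,
  [/\ oct_map Q s x <> x, oct_map Q t x <> x & oct_map Q s x <> oct_map Q t x].
Proof.
have cycP (c : 'S_4) : (c * c * c = 1)%g -> oct_map Q c x <> x -> exists s t,
  [/\ oct_map Q s x <> x, oct_map Q t x <> x & oct_map Q s x <> oct_map Q t x].
  move=> c3 cx; have c3x : oct_map Q c (oct_map Q c (oct_map Q c x)) = x.
    by have := congr1 (@^~ x) (oct_map1 oQ); rewrite -c3 !oct_mapM.
  exists c, (c * c)%g; rewrite oct_mapM //=; split=> // [e|e]; apply: cx.
    by rewrite -{2}c3x e.
  by rewrite -{2}c3x -!e.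
pose c1 : 'S_4 := (tperm 1%R 2%R * tperm 1%R 3%R)%g.
pose c2 : 'S_4 := (tperm 0%R 1%R * tperm 0%R 2%R)%g.
have c1_3 : (c1 * c1 * c1 = 1)%g.
  by apply/permP => k; rewrite perm1 /c1 /c2; have [->|->|->|->] := ord4P k; tperm_compute.
have c2_3 : (c2 * c2 * c2 = 1)%g.
  by apply/permP => k; rewrite perm1 /c1 /c2; have [->|->|->|->] := ord4P k; tperm_compute.
have [e1|] := pselect (oct_map Q c1 x = x); last exact: cycP.
have [e2|] := pselect (oct_map Q c2 x = x); last exact: cycP.
pose y := ccoord Q x.
have dinv (c : 'S_4) k : ~~ odd_perm c -> oct_map Q c x = x ->
    dot (diag (c k)) y = dot (diag k) y.
  move=> co cx; have cy : rot c *m y = y by rewrite /y -ccoord_oct_map // cx.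
  rewrite -[in LHS]cy dot_mulmx rot_tr.
  by rewrite rot_diag permK odd_permV (negPf co) scale1r.
have o1 : ~~ odd_perm c1 by rewrite odd_permM !odd_tperm.
have o2 : ~~ odd_perm c2 by rewrite odd_permM !odd_tperm.
have d12 : dot (diag 2) y = dot (diag 1) y.
  by rewrite -(dinv c1 1 o1 e1); congr (dot (diag _) y); rewrite /c1 /c2; tperm_compute.
have d23 : dot (diag 3) y = dot (diag 2) y.
  by rewrite -(dinv c1 2 o1 e1); congr (dot (diag _) y); rewrite /c1 /c2; tperm_compute.
have d01 : dot (diag 1) y = dot (diag 0) y.
  by rewrite -(dinv c2 0 o2 e2); congr (dot (diag _) y); rewrite /c1 /c2; tperm_compute.
have sum0 : dot (diag 0) y + dot (diag 1) y + dot (diag 2) y + dot (diag 3) y = 0.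
  by rewrite -!dotDl -big_ord4 sum_diag dotE !mxE !mul0r !addr0.
have d0 k : dot (diag k) y = 0.
  by have [->|->|->|->] := ord4P k; rewrite ?d23 ?d12 ?d01; rewrite d23 d12 d01 in sum0; lra.
have y0 i : y i 0 = 0.
  have [j [k [_ e]]] : exists j k, j != k /\ (-1) ^+ false *: axis i = 2^-1 *: (@diag R j + diag k).
    by apply/axis_diagP; exists i, false.
  by rewrite -dot_axis -[axis i]scale1r e dotZl dotDl !d0 addr0 mulr0.
by have /eqP := dot_ccoord oQ x; rewrite dotE -/y !y0 !mul0r !addr0 eq_sym oner_eq0.
Qed.

(** The odd 4-cycle (0 2 1 3) exchanges the pairs {0, 1} and {2, 3}, so it fixes the
    center of the face labelled by {0, 1}: it is a quarter turn about it. *)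
Lemma quarter_turn : exists (c : 'S_4) x, #[c]%g = 4%N /\ oct_map Q c x = x.
Proof.
pose c : 'S_4 := (tperm 0%R 2%R * tperm 0%R 1%R * tperm 0%R 3%R)%g.
have c0 : c 0 = 2 by rewrite /c; tperm_compute.
have c1 : c 1 = 3 by rewrite /c; tperm_compute.
have c2 : c 2 = 1 by rewrite /c; tperm_compute.
have c3 : c 3 = 0 by rewrite /c; tperm_compute.
have co : odd_perm c by rewrite !odd_permM !odd_tperm.
move: c c0 c1 c2 c3 co => c c0 c1 c2 c3 co.
have c4 : (c ^+ 4 = 1)%g.
  apply/permP => k; rewrite !expgS expg0 !permM !perm1.
  by have [->|->|->|->] := ord4P k; rewrite !(c0, c1, c2, c3).
have cc : (c ^+ 2 != 1)%g.
  by apply/eqP => /permP/(_ 0); rewrite !expgS expg0 !permM !perm1 c0 c2.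
have [x xE] := ccoord_surj oQ (@dot_axis_axis R 0); exists c, x; split.
  have : (#[c]%g %| 4)%N by rewrite order_dvdn c4.
  have : ~~ (#[c]%g %| 2)%N by rewrite order_dvdn.
  have := order_gt0 c; move: #[c]%g => n n0 n2 n4; have := @dvdn_leq n 4 isT n4.
  by case: n n0 n2 n4 => [|[|[|[|[|n]]]]].
apply: (ccoord_inj oQ); rewrite ccoord_oct_map // xE.
have axE : @axis R 0 = 2^-1 *: (diag 0 + diag 1).
  by apply: cV3_eq; rewrite !mxE /dsign /=; lra.
rewrite [in LHS]axE -scalemxAr mulmxDr !rot_diag c0 c1 co expr1.
by apply: cV3_eq; rewrite !mxE /dsign /= ?expr0 ?expr1; lra.
Qed.

End Blocks.

(** * The stabiliser of an invariant finite set *)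

Lemma lft_eq (R : realType) (f g : ecplane R -> ecplane R) (a b c : ecplane R) :
    is_lft f -> is_lft g -> a <> b -> a <> c -> b <> c ->
  f a = g a -> f b = g b -> f c = g c -> f = g.
Proof.
apply: eq_of_three_points (@is_lft_comp R) _ _ => h hL.
  by have [g' [g'L hg' _]] := is_lft_inv hL; exists g'.
by move=> /(lft_fix hL)[p [q [fixE _]]]; exists p, q => x /fixE.
Qed.

(** A linear fractional map is determined by its values at three points of A, so
    the stabiliser embeds into the self-maps of A. *)
Lemma lft_stab_finite (R : realType) (A : set (ecplane R)) (a b c : ecplane R) :
    finite_set A -> A a -> A b -> A c -> a <> b -> a <> c -> b <> c ->
  finite_set (lft_stab A).
Proof.
move=> /finite_seqP[s As] Aa Ab Ac ab ac bc.
pose F (h : ecplane R -> ecplane R) : {ffun seq_sub s -> seq_sub s} :=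
  [ffun u => insubd u (h (val u))].
have FE h x (xs : x \in s) : lft_stab A h -> val (F h (SeqSub xs)) = h x.
  move=> [_ hA]; rewrite ffunE val_insubd /=.
  suff -> : h x \in s by [].
  have : A (h x) by rewrite -hA; exists x => //; rewrite As.
  by rewrite As.
have F_inj : {in lft_stab A &, injective F}.
  move=> f g; rewrite !inE => fK gK fg; have [fL _] := fK; have [gL _] := gK.
  have fgx x : A x -> f x = g x.
    by move=> Ax; have xs : x \in s by [rewrite As in Ax]; rewrite -!(FE _ _ xs) // fg.
  by apply: (lft_eq fL gL ab ac bc); apply: fgx.
rewrite -(eq_finite_set (inj_card_eq F_inj)); exact: finite_finset.
Qed.

Lemma finite_iter (T : Type) (K : set (T -> T)) (f : T -> T) :
    finite_set K -> (forall n, K (iter n f)) -> injective f ->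
  exists2 m, (0 < m)%N & iter m f = id.
Proof.
move=> Kfin Kf f_inj; apply: contrapT => no_order.
have it_inj : injective (fun n => iter n f).
  have wlog_inj i j : (i < j)%N -> iter i f = iter j f -> False.
    move=> ij e; apply: no_order; exists (j - i)%N; first by rewrite subn_gt0.
    apply/funext => x; have := congr1 (@^~ x) e; rewrite -(subnKC (ltnW ij)) iterD.
    have it_i : injective (iter i f) by elim: i {ij e} => //= i IH y z /f_inj/IH.
    by rewrite addKn => /it_i.
  move=> i j e; case: (ltngtP i j) => // ij; first by case: (wlog_inj _ _ ij e).
  by case: (wlog_inj _ _ ij (esym e)).
apply: infinite_nat.
rewrite (_ : setT = (fun n => iter n f) @^-1` K); last first.
  by rewrite eqEsubset; split=> n // _; apply: Kf.
by apply: finite_preimage => // i j _ _; apply: it_inj.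
Qed.

Lemma lft_stab_two_fixed (R : realType) (A : set (ecplane R)) :
  finite_set (lft_stab A) -> two_fixed_group (lft_stab A).
Proof.
move=> Kfin.
have KM f g : lft_stab A f -> lft_stab A g -> lft_stab A (f \o g).
  by move=> [fL fA] [gL gA]; split; [exact: is_lft_comp|rewrite -image_comp gA].
split=> // [f [fL fA]|f fK f1].
  have [g [gL fg gf]] := is_lft_inv fL; exists g => //; split=> //.
  rewrite -{1}fA eqEsubset; split=> [_ [_ [x Ax <-] <-]|x Ax]; first by rewrite fg.
  by exists (f x); [exists x|rewrite fg].
have [fL fA] := fK; have [f' [_ ff' _]] := is_lft_inv fL.
have Kit n : lft_stab A (iter n f).
  elim: n => [|n IH]; last exact: (KM f (iter n f)).
  split; last by rewrite image_id.
  by exists 1, 0, 0, 1; rewrite lft_scalar ?oner_neq0 // mulr1 mulr0 subr0 oner_neq0.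
have [m m0 fm] := finite_iter Kfin Kit (can_inj ff').
have [p [q [fixE inf]]] := lft_fix fL f1.
by exists p, q; split=> // pq; apply: (inf pq m).
Qed.

Section Transport.
Context (R : realType) (Q : 'M[R]_3) (oQ : orthogonal_mx Q).

Lemma oct_lft_ex : exists Phi : 'S_4 -> ecplane R -> ecplane R,
  forall s, is_lft (Phi s) /\ Phi s \o @stereo R = @stereo R \o oct_map Q s.
Proof.
have ex s : exists h, is_lft h /\ h \o @stereo R = @stereo R \o oct_map Q s.
  have [h hL hE] := rotation_lft (oct_mx_rotation s oQ) (val_oct_map oQ s).
  by exists h.
by have [Phi PhiE] := choice ex; exists Phi.
Qed.

(** Every linear fractional map stabilises the empty set, in particular the
    translation by one, which fixes the north pole but not the south pole. *)
Lemma lft_stab_set0_neq : lft_stab set0 <> on_ecplane (octahedral Q).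
Proof.
move=> e; have : on_ecplane (octahedral Q) (lft 1 1 0 1).
  rewrite -e; split; last by rewrite image_set0.
  by exists 1, 1, 0, 1; split=> //; rewrite mulr1 mulr0 subr0 oner_neq0.
case=> g /(octahedralP oQ)[s ->] h.
have hE x : lft 1 1 0 1 (stereo x) = stereo (oct_map Q s x) by exact: (congr1 (@^~ x) h).
have [N NE] := @stereo_surj R None; have [S SE] := @stereo_surj R (Some 0).
have NSE : val S = - val N.
  rewrite -!stereoK NE SE /=; apply: cV3_eq;
    by rewrite !mxE /= ?expr0n /= ?addr0 invr1 mul1r ?mul0rn ?oppr0 ?mulr0n ?sub0r.
have gN : oct_map Q s N = N.
  by apply: stereo_inj; rewrite -hE NE /= eqxx.
have gS : oct_map Q s S = S.
  apply: val_inj; rewrite val_oct_map // NSE mulmxN -val_oct_map //.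
  by rewrite gN.
have := hE S; rewrite gS SE /= mul0r add0r oner_eq0 mulr0 add0r divr1 => -[].
by move=> /eqP; rewrite oner_eq0.
Qed.

Lemma on_ecplaneE (Phi : 'S_4 -> ecplane R -> ecplane R) :
    (forall s, Phi s \o @stereo R = @stereo R \o oct_map Q s) ->
  on_ecplane (octahedral Q) = range Phi.
Proof.
move=> PhiE; rewrite eqEsubset; split=> [h [g /(octahedralP oQ)[s ->] hE]|_ [s _ <-]].
  exists s => //; apply/funext => z; have [x <-] := stereo_surj z.
  by rewrite -[LHS]/((Phi s \o @stereo R) x) PhiE -hE.
by exists (oct_map Q s) => //; apply/octahedralP => //; exists s.
Qed.

(** The octahedral rotations, seen in the plane as the maps [Phi s], stabilise the
    image of an invariant set. The stabiliser is then finite because an orbit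
    has at least three points, and it is no larger by [two_fixed_group_max],
    applied to a quarter turn. *)
Lemma lft_stab_octahedralP (alpha : set (sphere R)) : finite_set alpha ->
  lft_stab [set stereo x | x in alpha] = on_ecplane (octahedral Q) <->
  alpha !=set0 /\ forall s x, alpha x -> alpha (oct_map Q s x).
Proof.
move=> afin; have [Phi PhiE] := oct_lft_ex.
have Phix s x : Phi s (stereo x) = stereo (oct_map Q s x).
  exact: (congr1 (@^~ x) (PhiE s).2).
rewrite (@on_ecplaneE Phi) => [|s]; last by case: (PhiE s).
have rangeE := @on_ecplaneE Phi (fun s => (PhiE s).2).
split=> [e|[[x ax] astab]].
  split.
    apply: contrapT => /nonemptyPn a0; apply: lft_stab_set0_neq.
    by rewrite rangeE -e a0 image_set0.
  move=> s x ax; have : lft_stab (@stereo R @` alpha) (Phi s) by rewrite e; exists s.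
  case=> _ PhiA; have : (@stereo R @` alpha) (stereo (oct_map Q s x)).
    by rewrite -Phix -PhiA; exists (stereo x) => //; exists x.
  by case=> y ay /stereo_inj <-.
have PhiK s : lft_stab (@stereo R @` alpha) (Phi s).
  split; first by case: (PhiE s).
  rewrite eqEsubset; split=> [_ [_ [y ay <-] <-]|_ [y ay <-]].
    by rewrite Phix; exists (oct_map Q s y); [exact: astab|].
  exists (stereo (oct_map Q s^-1%g y)); first by exists (oct_map Q s^-1%g y); [exact: astab|].
  rewrite Phix; congr (stereo _); have := congr1 (@^~ y) (oct_mapM oQ s^-1%g s).
  by rewrite mulVg oct_map1.
have [s [t [sx tx st]]] := orbit_three oQ x.
have Kfin : finite_set (lft_stab (@stereo R @` alpha)).
  apply: (@lft_stab_finite _ _ (stereo x) (stereo (oct_map Q s x)) (stereo (oct_map Q t x))).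
  - exact: finite_image.
  - by exists x.
  - by exists (oct_map Q s x); [exact: astab|].
  - by exists (oct_map Q t x); [exact: astab|].
  - by move=> /stereo_inj/esym/sx.
  - by move=> /stereo_inj/esym/tx.
  - by move=> /stereo_inj/st.
have [c [y [c4 cy]]] := quarter_turn oQ.
have [u [v [uy vy uv]]] := orbit_three oQ y.
have Phi_inj : injective Phi.
  move=> a b ab; apply: (oct_map_inj oQ); apply/funext => z.
  by have := congr1 (@^~ (stereo z)) ab; rewrite /= !Phix => /stereo_inj.
have Phi1 : Phi 1%g = id.
  by apply/funext => z; have [w <-] := stereo_surj z; rewrite Phix oct_map1.
have PhiM a b : Phi (a * b)%g = Phi b \o Phi a.
  apply/funext => z; have [w <-] := stereo_surj z.
  by rewrite /= !Phix oct_mapM.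
have cardS4 : #|{: 'S_4}| = 24%N by rewrite card_Sn.
have cy' : Phi c (stereo y) = stereo y by rewrite Phix cy.
have uy' : Phi u (stereo y) <> stereo y by rewrite Phix => /stereo_inj/uy.
have vy' : Phi v (stereo y) <> stereo y by rewrite Phix => /stereo_inj/vy.
have uv' : Phi u (stereo y) <> Phi v (stereo y) by rewrite !Phix => /stereo_inj/uv.
exact: (@two_fixed_group_max (option R[i]) _ _ Phi _ _ _ _
  (lft_stab_two_fixed Kfin) PhiK Phi_inj Phi1 PhiM cardS4 c4 cy' uy' vy' uv').
Qed.

End Transport.

Theorem theorem10 (R : realType) (Q : 'M[R]_3) (hQ : orthogonal_mx Q) :
  isog_S4 (octahedral Q) /\
  forall alpha : set (sphere R), finite_set alpha ->
    (lft_stab [set stereo x | x in alpha] = on_ecplane (octahedral Q)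
     <->
     exists S : set (set (sphere R)),
       [/\ S `<=` octahedral_blocks Q, S !=set0
         & alpha = \bigcup_(B in S) B]).
Proof.
split=> [|alpha alpha_fin]; first exact: isog_octahedral.
by rewrite union_blocksP //; apply: lft_stab_octahedralP.
Qed.
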